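(* Let $\mathcal{G}=(V,\mathcal{E})$ be a temporal graph with $m=|\mathcal{E}|$ and let $\Delta\in\mathbb{N}$. The $(k,\Delta)$-core decomposition algorithm given in the context computes the core numbers $c_\Delta(e)$ of all $e\in\mathcal{E}$ correctly in $\mathcal{O}(m\cdot\max(\log\delta_m,\xi))$ time and $\mathcal{O}(m)$ space.
   Context: A temporal graph $\mathcal{G}=(V,\mathcal{E})$ consists of a finite set $V$ of nodes and a finite set $\mathcal{E}$ of undirected temporal edges $e=(\{u,v\},t)$ with $u,v\in V$, $u\ne v$, and timestamp $t\in\mathbb{N}$. Let $n=|V|$, $m=|\mathcal{E}|$; it is assumed that $n\le 2m$. $\delta_m$ is the maximum degree in $\mathcal{G}$ (maximum number of temporal edges incident to a node). The edges incident to each node are stored in chronologically ordered incidence lists. Running times are in the standard RAM model. Two edges $(\{u,v\},t)$ and $(\{u,w\},t')$ sharing a node are $\Delta$-incident if $|t-t'|\le\Delta$; each edge is considered $\Delta$-incident to itself. $\xi$ is the maximum, over $e\in\mathcal{E}$, of the number of edges $\Delta$-incident to $e$. For $\mathcal{E}'\subseteq\mathcal{E}$ and $e=(\{u,v\},t)\in\mathcal{E}$, the $\Delta$-degree is $$d_\Delta(e,\mathcal{E}')=\min\big(|\{(\{u,w\},t')\in\mathcal{E}' : |t-t'|\le\Delta\}|,\ |\{(\{v,w\},t')\in\mathcal{E}' : |t-t'|\le\Delta\}|\big).$$ The $(k,\Delta)$-core of $\mathcal{G}$ is the inclusion-maximal edge-induced subgraph, with edge set $\mathcal{F}$, such that $d_\Delta(e,\mathcal{F})\ge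 k$ for all $e\in\mathcal{F}$. The core number $c_\Delta(e)$ is the largest $k$ such that $e$ belongs to the $(k,\Delta)$-core. $(k,\Delta)$-core decomposition algorithm. Input: $\mathcal{G}$, $\Delta$. (1) For each $e=(\{u,v\},t)\in\mathcal{E}$ set $a_u[e]=|\{(\{u,w\},t')\in\mathcal{E} : |t-t'|\le\Delta\}|$, $a_v[e]=|\{(\{v,w\},t')\in\mathcal{E} : |t-t'|\le\Delta\}|$ and $d[e]=\min(a_u[e],a_v[e])$. (2) Bin sort the edges in increasing order of $d[e]$. (3) Process the edges in the (dynamically maintained) sorted order: for the current edge $e=(\{u,v\},t)$, for each edge $f=(\{x,w\},t')$ still in the graph with $x\in\{u,v\}$, if $|t-t'|\le\Delta$ and $d[f]>d[e]$, then set $a_x[f]\leftarrow a_x[f]-1$, $d[f]\leftarrow\min(a_x[f],a_w[f])$ and update the bin position of $f$; the relevant range of $\Delta$-incident edges $f$ in each incidence list is located in $\mathcal{O}(\log\delta_m)$ time. Then remove $e$ from $\mathcal{G}$. (4) Return $d$. *)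

(* Defs.v *)
From HB Require Import structures.
From mathcomp Require Import all_boot all_order all_algebra.
From mathcomp Require Import finmap.

Set Implicit Arguments.
Unset Strict Implicit.
Unset Printing Implicit Defensive.

Import IntDist.
Local Open Scope fset_scope.
Local Open Scope nat_scope.

(** * Temporal graphs and (k, Delta)-cores *)

(* The edge ({u, v}, t) is the pair ([set u; v], t); parallel edges with
   different timestamps are allowed. *)
Notation tedge V := ({set V} * nat)%type.

(* #|e.1| = 2 says that the two endpoints of e are distinct. *)
Record tgraph (V : finType) := TGraph {
  tedges :> {fset tedge V};
  tedgesP : forall e, e \in tedges -> #|e.1| = 2
}.

Section TemporalGraph.
Variables (V : finType) (G : tgraph V) (Delta : nat).
Implicit Types (u v w : V) (t k : nat) (e f : tedge V) (F : {fset tedge V}).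

Definition msize : nat := #|` tedges G |.

Definition incident v : {fset tedge V} := [fset e in tedges G | v \in e.1].

Definition tdeg v : nat := #|` incident v |.

Definition max_tdeg : nat := \max_(v : V) tdeg v.

Definition near_time t t' : bool := `|t - t'|%N <= Delta.

Definition dincident e f : bool :=
  (e.1 :&: f.1 != set0)%SET && near_time e.2 f.2.

Definition xi : nat :=
  \max_(e <- tedges G) #|` [fset f in tedges G | dincident e f] |.

Definition near_count F v t : nat :=
  #|` [fset f in F | (v \in f.1) && near_time t f.2] |.

(* The Delta-degree d_Delta(e, F) of the edge e = ({u, v}, t). *)
Definition ddeg u v t F : nat := minn (near_count F u t) (near_count F v t).

Definition all_ddeg_ge k F : Prop :=
  forall u v t, ([set u; v]%SET, t) \in F -> k <= ddeg u v t F.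

(* An edge-induced subgraph is identified with its edge set. *)
Definition is_core k F : Prop :=
  [/\ F `<=` tedges G, all_ddeg_ge k F &
      forall F', F' `<=` tedges G -> all_ddeg_ge k F' -> F `<=` F' -> F' = F].

Definition is_core_number e k : Prop :=
  (exists2 F, is_core k F & e \in F) /\
  (forall k' F, is_core k' F -> e \in F -> k' <= k).

End TemporalGraph.

(** * Random access machine *)

(* The memory consists of named arrays of natural numbers; every expression
   node, test and memory update is one machine operation of unit cost.  There
   is no multiplication, so cell contents grow by at most one bit per
   operation. *)
Variant arr := Arr of nat.
Definition arr_id a := let: Arr k := a in k.
Lemma arr_idK : cancel arr_id Arr. Proof. by case. Qed.
HB.instance Definition _ := Equality.copy arr (can_type arr_idK).

Definition memory := arr -> nat -> nat.
Definition cell := (arr * nat)%type.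

Definition upd (s : memory) (a : arr) (i x : nat) : memory :=
  fun b j => if (b == a) && (j == i) then x else s b j.

Inductive expr :=
| Num of nat
| Get of arr & expr
| Add of expr & expr
| Sub of expr & expr
| Half of expr.

Variant test :=
| Less of expr & expr
| Leq of expr & expr
| Same of expr & expr.

Inductive cmd :=
| Skip
| Put of arr & expr & expr
| Seq of cmd & cmd
| If of test & cmd & cmd
| While of test & cmd.

Fixpoint eval (s : memory) (a : expr) : nat :=
  match a with
  | Num n => n
  | Get x i => s x (eval s i)
  | Add a1 a2 => eval s a1 + eval s a2
  | Sub a1 a2 => eval s a1 - eval s a2
  | Half a1 => (eval s a1)./2
  end.

Fixpoint ecost (a : expr) : nat :=
  match a with
  | Num _ => 1
  | Get _ i => (ecost i).+1
  | Add a1 a2 | Sub a1 a2 => (ecost a1 + ecost a2).+1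
  | Half a1 => (ecost a1).+1
  end.

Fixpoint ecells (s : memory) (a : expr) : seq cell :=
  match a with
  | Num _ => [::]
  | Get x i => rcons (ecells s i) (x, eval s i)
  | Add a1 a2 | Sub a1 a2 => ecells s a1 ++ ecells s a2
  | Half a1 => ecells s a1
  end.

Definition teval (s : memory) (b : test) : bool :=
  match b with
  | Less a1 a2 => eval s a1 < eval s a2
  | Leq a1 a2 => eval s a1 <= eval s a2
  | Same a1 a2 => eval s a1 == eval s a2
  end.

Definition tcost (b : test) : nat :=
  match b with
  | Less a1 a2 | Leq a1 a2 | Same a1 a2 => (ecost a1 + ecost a2).+1
  end.

Definition tcells (s : memory) (b : test) : seq cell :=
  match b with
  | Less a1 a2 | Leq a1 a2 | Same a1 a2 => ecells s a1 ++ ecells s a2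
  end.

(* [exec c s s' t L]: started in memory s, the program c halts in memory s'
   after t operations, having accessed (read or written) the cells in L. *)
Inductive exec : cmd -> memory -> memory -> nat -> seq cell -> Prop :=
| ExecSkip s : exec Skip s s 1 [::]
| ExecPut s x i a :
    exec (Put x i a) s (upd s x (eval s i) (eval s a))
      (ecost i + ecost a).+1 (rcons (ecells s i ++ ecells s a) (x, eval s i))
| ExecSeq c1 c2 s s1 s2 t1 t2 L1 L2 :
    exec c1 s s1 t1 L1 -> exec c2 s1 s2 t2 L2 ->
    exec (Seq c1 c2) s s2 (t1 + t2) (L1 ++ L2)
| ExecIf b c1 c2 s s' t L :
    exec (if teval s b then c1 else c2) s s' t L ->
    exec (If b c1 c2) s s' (tcost b + t) (tcells s b ++ L)
| ExecWhileEnd b c s :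
    ~~ teval s b -> exec (While b c) s s (tcost b) (tcells s b)
| ExecWhileStep b c s s1 s2 t1 t2 L1 L2 :
    teval s b -> exec c s s1 t1 L1 -> exec (While b c) s1 s2 t2 L2 ->
    exec (While b c) s s2 (tcost b + t1 + t2) (tcells s b ++ L1 ++ L2).

(* The machine is deterministic. *)
Lemma exec_det c s s1 s2 t1 t2 L1 L2 :
  exec c s s1 t1 L1 -> exec c s s2 t2 L2 -> [/\ s1 = s2, t1 = t2 & L1 = L2].
Proof.
move=> H; elim: H s2 t2 L2 => {c s s1 t1 L1}
  [s|s x i a|c1 c2 s s1 s2 t1 t2 L1 L2 _ IH1 _ IH2|b c1 c2 s s1 t L _ IH
  |b c s /negP Nb|b c s s1 s2 t1 t2 L1 L2 Hb _ IH1 _ IH2] s' t' L' H;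
  inversion H; subst=> //;
  repeat match goal with
  | IH : forall _ _ _, exec ?c ?s _ _ _ -> _, K : exec ?c ?s _ _ _ |- _ =>
      case: (IH _ _ _ K) => ? ? ?; subst; clear IH
  | K : is_true (~~ _) |- _ => by rewrite Hb in K
  end; by [].
Qed.

(* A scalar variable is an array of which only cell 0 is used. *)
Definition scalar (x : arr) : expr := Get x (Num 0).
Coercion scalar : arr >-> expr.
Coercion Num : nat >-> expr.

Declare Scope ram_scope.
Delimit Scope ram_scope with ram.
Notation "a @[ i ]" := (Get a i) (at level 2, i at level 69, left associativity,
  format "a @[ i ]") : ram_scope.
Notation "a @[ i <~ x ]" := (Put a i x) (at level 2, i at level 69,
  x at level 200, format "a @[ i  <~  x ]") : ram_scope.
Notation "x <~ a" := (Put x (Num 0) a) (at level 70) : ram_scope.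
Notation "a +' b" := (Add a b) (at level 50, left associativity) : ram_scope.
Notation "a -' b" := (Sub a b) (at level 50, left associativity) : ram_scope.
Notation "c ;; d" := (Seq c d) (at level 90, right associativity,
  format "c  ;; '/' d") : ram_scope.

Definition For (x : arr) (a b : expr) (c : cmd) : cmd :=
  (x <~ a ;; While (Less x b) (c ;; x <~ x +' 1))%ram.

(** * The input *)

(* Nodes and edges are numbered from 0.  Edge number i joins nodes number
   in_src[i] and in_dst[i] at time in_time[i].  The incidence list of node
   number i holds edge numbers and is stored in
   in_inc[in_off[i]], ..., in_inc[in_off[i+1] - 1]. *)
Definition in_n     := Arr 0.
Definition in_m     := Arr 1.
Definition in_Delta := Arr 2.
Definition in_src   := Arr 3.
Definition in_dst   := Arr 4.
Definition in_time  := Arr 5.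
Definition in_off   := Arr 6.
Definition in_inc   := Arr 7.

Definition input_cells (n m : nat) : seq cell :=
  [:: (in_n, 0); (in_m, 0); (in_Delta, 0)]
  ++ [seq (a, i) | a <- [:: in_src; in_dst; in_time], i <- iota 0 m]
  ++ [seq (in_off, i) | i <- iota 0 n.+1]
  ++ [seq (in_inc, i) | i <- iota 0 (2 * m)].

(* The memory s holds the graph G and Delta, for the node numbering nu and the
   edge numbering eps; all cells that are not input cells are arbitrary. *)
Record encodes (V : finType) (G : tgraph V) (Delta : nat)
    (nu : V -> nat) (eps : tedge V -> nat) (s : memory) : Prop := Encodes {
  enc_nu_inj : injective nu;
  enc_nu_lt : forall v, nu v < #|V|;
  enc_eps_inj : {in tedges G &, injective eps};
  enc_eps_lt : forall e, e \in tedges G -> eps e < msize G;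
  enc_n : s in_n 0 = #|V|;
  enc_m : s in_m 0 = msize G;
  enc_Delta : s in_Delta 0 = Delta;
  enc_edge : forall e, e \in tedges G -> exists u v,
    [/\ e.1 = [set u; v]%SET, s in_src (eps e) = nu u,
        s in_dst (eps e) = nu v & s in_time (eps e) = e.2];
  enc_off0 : s in_off 0 = 0;
  enc_off : forall v, s in_off (nu v).+1 = s in_off (nu v) + tdeg G v;
  enc_inc : forall v, exists es : seq (tedge V),
    [/\ perm_eq es (incident G v), sorted leq [seq e.2 | e <- es] &
        [seq s in_inc j | j <- iota (s in_off (nu v)) (tdeg G v)]
        = [seq eps e | e <- es]]
}.

(** * The (k, Delta)-core decomposition algorithm *)

(* Per edge f = ({x, w}, t'), with x = in_src[f] and w = in_dst[f]:
   au[f], av[f] are a_x[f], a_w[f]; dval[f] is d[f]; alive[f] = 1 iff f has not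
   been removed yet. *)
Definition au    := Arr 8.
Definition av    := Arr 9.
Definition dval  := Arr 10.
Definition alive := Arr 11.
(* ord is the sorted list of the edges, pos its inverse, and bin[k] the
   position in ord of the first edge f with d[f] >= k. *)
Definition ord   := Arr 12.
Definition pos   := Arr 13.
Definition bin   := Arr 14.
(* The v_ names are scalars. *)
Definition v_i   := Arr 15.
Definition v_j   := Arr 16.
Definition v_k   := Arr 17.
Definition v_e   := Arr 18.
Definition v_f   := Arr 19.
Definition v_g   := Arr 20.
Definition v_x   := Arr 21.
Definition v_t   := Arr 22.
Definition v_l   := Arr 23.
Definition v_r   := Arr 24.
Definition v_mid := Arr 25.
Definition v_lo  := Arr 26.
Definition v_hi  := Arr 27.
Definition v_old := Arr 28.
Definition v_pf  := Arr 29.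
Definition v_pg  := Arr 30.
Definition v_num := Arr 31.
Definition v_sum := Arr 32.

Section Program.
Local Open Scope ram_scope.

(* Binary search in the incidence list of v_x for the first position at which
   the test [before], about position v_mid, fails. *)
Definition bsearch (before : test) (res : arr) : cmd :=
  v_l <~ in_off@[v_x] ;;
  v_r <~ in_off@[v_x +' 1] ;;
  While (Less v_l v_r) (
    v_mid <~ Half (v_l +' v_r) ;;
    If before (v_l <~ v_mid +' 1) (v_r <~ v_mid)) ;;
  res <~ v_l.

(* The edges with timestamp within Delta of v_t in the incidence list of v_x
   are those at the positions v_lo, ..., v_hi - 1 of in_inc. *)
Definition locate : cmd :=
  bsearch (Less (in_time@[in_inc@[v_mid]] +' in_Delta) v_t) v_lo ;;
  bsearch (Leq in_time@[in_inc@[v_mid]] (v_t +' in_Delta)) v_hi.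

Definition set_min (res : arr) (i a b : expr) : cmd :=
  If (Leq a b) (res@[i <~ a]) (res@[i <~ b]).

Definition init_degrees : cmd :=
  For v_e 0 in_m (
    v_t <~ in_time@[v_e] ;;
    v_x <~ in_src@[v_e] ;;
    locate ;;
    au@[v_e <~ v_hi -' v_lo] ;;
    v_x <~ in_dst@[v_e] ;;
    locate ;;
    av@[v_e <~ v_hi -' v_lo] ;;
    set_min dval v_e au@[v_e] av@[v_e] ;;
    alive@[v_e <~ 1]).

(* Counting sort: the values d[e] are at most m.  The last For loop leaves in
   bin[k] the start of bin k + 1, hence the final shift. *)
Definition bin_sort : cmd :=
  For v_k 0 (in_m +' 1) (bin@[v_k <~ 0]) ;;
  For v_e 0 in_m (bin@[dval@[v_e] <~ bin@[dval@[v_e]] +' 1]) ;;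
  v_sum <~ 0 ;;
  For v_k 0 (in_m +' 1) (
    v_num <~ bin@[v_k] ;;
    bin@[v_k <~ v_sum] ;;
    v_sum <~ v_sum +' v_num) ;;
  For v_e 0 in_m (
    pos@[v_e <~ bin@[dval@[v_e]]] ;;
    ord@[pos@[v_e] <~ v_e] ;;
    bin@[dval@[v_e] <~ bin@[dval@[v_e]] +' 1]) ;;
  v_k <~ in_m ;;
  While (Less 0 v_k) (
    bin@[v_k <~ bin@[v_k -' 1]] ;;
    v_k <~ v_k -' 1) ;;
  bin@[0 <~ 0].

(* Move the edge v_f from bin v_old to bin v_old - 1, by exchanging it with
   the first edge v_g of its bin. *)
Definition rebin : cmd :=
  v_pf <~ pos@[v_f] ;;
  v_pg <~ bin@[v_old] ;;
  v_g <~ ord@[v_pg] ;;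
  ord@[v_pf <~ v_g] ;;
  pos@[v_g <~ v_pf] ;;
  ord@[v_pg <~ v_f] ;;
  pos@[v_f <~ v_pg] ;;
  bin@[v_old <~ bin@[v_old] +' 1].

(* Update of the edge v_f, incident to the endpoint v_x of v_e; d[f] drops by
   at most 1. *)
Definition update_edge : cmd :=
  If (Same in_src@[v_f] v_x)
    (au@[v_f <~ au@[v_f] -' 1])
    (av@[v_f <~ av@[v_f] -' 1]) ;;
  v_old <~ dval@[v_f] ;;
  set_min dval v_f au@[v_f] av@[v_f] ;;
  If (Less dval@[v_f] v_old) rebin Skip.

Definition scan_endpoint : cmd :=
  locate ;;
  For v_j v_lo v_hi (
    v_f <~ in_inc@[v_j] ;;
    If (Same alive@[v_f] 1)
      (If (Less dval@[v_e] dval@[v_f]) update_edge Skip)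
      Skip).

Definition peel : cmd :=
  For v_i 0 in_m (
    v_e <~ ord@[v_i] ;;
    v_t <~ in_time@[v_e] ;;
    v_x <~ in_src@[v_e] ;;
    scan_endpoint ;;
    v_x <~ in_dst@[v_e] ;;
    scan_endpoint ;;
    alive@[v_e <~ 0]).

(* The result is returned in the array dval. *)
Definition core_decomposition : cmd :=
  init_degrees ;; bin_sort ;; peel.

End Program.

(* The space of a run that accesses the cells in L, the input included. *)
Definition space (n m : nat) (L : seq cell) : nat :=
  size (undup (input_cells n m ++ L)).

(* Main.v *)
(** Call d[f] the value of f and the value of the edge being removed the level;
    the level never decreases, and no value ever drops below it.  A counter a_x[f]
    of a remaining edge f with value above the level is exact: it is the number of
    remaining edges at x within Delta of f, as each removal is discounted once at
    each endpoint.  Two invariants follow.  If F has minimum Delta-degree k, its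
    edges keep values at least k: as long as the level is below k no edge of F is
    removed, so the exact counters stay at least k, and afterwards the level
    protects them.  Conversely, when the level first reaches k, the remaining edges
    are those of value at least k and their counters are exact, so they form a
    subgraph of minimum Delta-degree at least k, and this edge set no longer
    changes.  Hence the final values are the core numbers.

    A value drops by one at a time, so one exchange in the sorted array and one
    shift of a bin border keep the edges sorted.  Processing an edge takes four
    binary searches and at most xi constant-time updates per endpoint. *)
Require Import Defs.
From mathcomp Require Import all_boot finmap zify.

Set Implicit Arguments.
Unset Strict Implicit.
Unset Printing Implicit Defensive.


(** * Hoare triples with time and space bounds *)

(* 33 is the number of arrays of the program.  Taking [B = 2 * m] covers every
   index in use, because n <= 2 * m and the incidence lists have total length
   2 * m. *)
Definition okc (B : nat) (c : cell) : bool := (arr_id c.1 < 33) && (c.2 <= B).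

Fixpoint writes (c : cmd) : seq arr :=
  match c with
  | Skip => [::]
  | Put x _ _ => [:: x]
  | Seq c1 c2 | If _ c1 c2 => writes c1 ++ writes c2
  | While _ c1 => writes c1
  end.

Lemma exec_frame c s s' t L a :
  exec c s s' t L -> a \notin writes c -> s' a = s a.
Proof.
elim=> {c s s' t L} //=.
- by move=> s x i b; rewrite inE /upd => /negbTE ->.
- move=> c1 c2 s s1 s2 t1 t2 L1 L2 _ IH1 _ IH2.
  by rewrite mem_cat negb_or => /andP[n1 n2]; rewrite IH2 ?IH1.
- move=> b c1 c2 s s' t L _ IH; rewrite mem_cat negb_or => /andP[n1 n2].
  by apply: IH; case: ifP.
- by move=> b c s s1 s2 t1 t2 L1 L2 _ _ IH1 _ IH2 na; rewrite IH2 ?IH1.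
Qed.

(** Total correctness: the existential asserts termination, and by [exec_det] the run exhibited is
    the only one, so time and cell bounds hold for the run of the program. *)
Definition runs B c s T (Q : memory -> Prop) : Prop :=
  exists s' t L, [/\ exec c s s' t L, t <= T, all (okc B) L & Q s'].

Lemma runs_weaken B c s T T' (Q Q' : memory -> Prop) :
  runs B c s T Q -> T <= T' -> (forall s', Q s' -> Q' s') -> runs B c s T' Q'.
Proof.
move=> [s' [t [L [He Ht HL HQ]]]] TT' QQ'; exists s', t, L.
by split=> //; [exact: leq_trans TT' | exact: QQ'].
Qed.

Lemma runs_le B c s T T' Q : runs B c s T Q -> T <= T' -> runs B c s T' Q.
Proof. by move=> H TT'; apply: runs_weaken H TT' _. Qed.

Lemma runs_frame B c s T Q :
  runs B c s T Q ->
  runs B c s T (fun s' => Q s' /\ forall a, a \notin writes c -> s' a = s a).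
Proof.
move=> [s' [t [L [He Ht HL HQ]]]]; exists s', t, L; split=> //; split=> // a.
exact: exec_frame He.
Qed.

Lemma runs_seq B c1 c2 s T1 T2 P Q :
  runs B c1 s T1 P -> (forall s', P s' -> runs B c2 s' T2 Q) ->
  runs B (Seq c1 c2) s (T1 + T2) Q.
Proof.
move=> [s1 [t1 [L1 [He1 Ht1 HL1 HP]]]] /(_ _ HP)[s2 [t2 [L2 [He2 Ht2 HL2 HQ]]]].
exists s2, (t1 + t2), (L1 ++ L2); split=> //; last by rewrite all_cat HL1.
  exact: ExecSeq He1 He2.
exact: leq_add.
Qed.

Lemma runs_seq_frame B c1 c2 s T1 T2 P Q :
  runs B c1 s T1 P ->
  (forall s', P s' -> (forall a, a \notin writes c1 -> s' a = s a) ->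
     runs B c2 s' T2 Q) ->
  runs B (Seq c1 c2) s (T1 + T2) Q.
Proof.
move=> /runs_frame H1 H2; apply: runs_seq H1 _ => s' [HP Hf]; exact: H2.
Qed.

(* Weakest precondition of a loop-free command. *)
Fixpoint vc B c s (Q : memory -> Prop) : Prop :=
  match c with
  | Skip => Q s
  | Put x i a =>
      all (okc B) (rcons (ecells s i ++ ecells s a) (x, eval s i)) /\
      Q (upd s x (eval s i) (eval s a))
  | Seq c1 c2 => vc B c1 s (fun s1 => vc B c2 s1 Q)
  | If b c1 c2 =>
      all (okc B) (tcells s b) /\
      (if teval s b then vc B c1 s Q else vc B c2 s Q)
  | While _ _ => False
  end.

(** A bound only where [vc] holds; as [vc] is false on loops, the value 0 there does no harm. *)
Fixpoint max_cost c : nat :=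
  match c with
  | Skip => 1
  | Put _ i a => (ecost i + ecost a).+1
  | Seq c1 c2 => max_cost c1 + max_cost c2
  | If b c1 c2 => tcost b + maxn (max_cost c1) (max_cost c2)
  | While _ _ => 0
  end.

Lemma vc_runs B c s Q : vc B c s Q -> runs B c s (max_cost c) Q.
Proof.
elim: c s Q => //=.
- by move=> s Q HQ; exists s, 1, [::]; split=> //; constructor.
- move=> x i a s Q [Hok HQ].
  by do 3!eexists; split; [exact: ExecPut | | |].
- by move=> c1 IH1 c2 IH2 s Q H; apply: runs_seq (IH1 _ _ H) _ => s1; apply: IH2.
- move=> b c1 IH1 c2 IH2 s Q [Hok H].
  have: runs B (if teval s b then c1 else c2) s
    (maxn (max_cost c1) (max_cost c2)) Q.
    case: (teval s b) H => H; [apply: runs_weaken (IH1 _ _ H) _ _ |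
      apply: runs_weaken (IH2 _ _ H) _ _] => //; lia.
  move=> [s' [t [L [He Ht HL HQ]]]]; exists s', (tcost b + t), (tcells s b ++ L).
  split=> //; [exact: ExecIf | lia | by rewrite all_cat Hok].
Qed.

Lemma vc_runs_le B c s T Q : vc B c s Q -> max_cost c <= T -> runs B c s T Q.
Proof. by move=> /vc_runs; apply: runs_le. Qed.

Lemma runs_vc_seq B c1 c2 s T2 Q :
  vc B c1 s (fun s' => runs B c2 s' T2 Q) ->
  runs B (Seq c1 c2) s (max_cost c1 + T2) Q.
Proof. by move=> /vc_runs H; apply: runs_seq H _. Qed.

Lemma runs_if B b c1 c2 s T Q :
  all (okc B) (tcells s b) ->
  (teval s b -> runs B c1 s T Q) -> (~~ teval s b -> runs B c2 s T Q) ->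
  runs B (If b c1 c2) s (tcost b + T) Q.
Proof.
move=> Hok H1 H2.
have [s' [t [L [He Ht HL HQ]]]]: runs B (if teval s b then c1 else c2) s T Q.
  by case E: (teval s b); [apply: H1; rewrite E|apply: H2; rewrite E].
exists s', (tcost b + t), (tcells s b ++ L).
split=> //; [exact: ExecIf | lia | by rewrite all_cat Hok].
Qed.

Lemma runs_while_end B b c s (Q : memory -> Prop) :
  all (okc B) (tcells s b) -> ~~ teval s b -> Q s ->
  runs B (While b c) s (tcost b) Q.
Proof.
by move=> Hok Hb HQ; do 3!eexists; split; [exact: ExecWhileEnd | | |].
Qed.

Lemma runs_while_step B b c s T1 T2 P Q :
  all (okc B) (tcells s b) -> teval s b -> runs B c s T1 P ->
  (forall s', P s' -> runs B (While b c) s' T2 Q) ->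
  runs B (While b c) s (tcost b + T1 + T2) Q.
Proof.
move=> Hok Hb [s1 [t1 [L1 [He1 Ht1 HL1 HP]]]] /(_ _ HP).
move=> [s2 [t2 [L2 [He2 Ht2 HL2 HQ]]]].
exists s2, (tcost b + t1 + t2), (tcells s b ++ L1 ++ L2); split=> //.
- exact: ExecWhileStep He1 He2.
- lia.
- by rewrite !all_cat Hok HL1.
Qed.

(** [I i] describes the memory once the counter holds i. The bound [b] is evaluated anew at every
    test, so the invariant has to keep its value at [hi]. The 9 is 3 for the test, apart from [b],
    plus 6 for the increment. *)
Lemma runs_for B (x : arr) a b c s T lo hi (I : nat -> memory -> Prop) :
  arr_id x < 33 -> x \notin writes c -> lo <= hi ->
  eval s a = lo -> all (okc B) (ecells s a) ->
  I lo (upd s x 0 lo) ->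
  (forall i s1, I i s1 -> s1 x 0 = i ->
     eval s1 b = hi /\ all (okc B) (ecells s1 b)) ->
  (forall i s1, lo <= i < hi -> I i s1 -> s1 x 0 = i ->
     runs B c s1 T (fun s2 => I i.+1 (upd s2 x 0 i.+1))) ->
  runs B (For x a b c) s
    ((hi - lo) * (T + ecost b + 9) + (ecost a + ecost b + 5))
    (I hi).
Proof.
move=> x33 xw lohi Ea oka I0 Hb Hc.
have okx i : i = 0 -> okc B (x, i) by move=> ->; rewrite /okc x33.
have loop d i s1 : hi = i + d -> lo <= i -> I i s1 -> s1 x 0 = i ->
  runs B (While (Less x b) (Seq c (Put x 0 (Add x 1)))) s1
    (d * (T + ecost b + 9) + (ecost b + 3)) (I hi).
  elim: d i s1 => [|d IH] i s1 Ehi loi HI xi; have [Eb okb] := Hb _ _ HI xi.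
    apply: runs_weaken (runs_while_end (Q := I hi) _ _ _ _) _ _ => /=.
    - by rewrite okx.
    - by rewrite Eb xi; lia.
    - have -> : hi = i by lia.
      exact: HI.
    - lia.
    - by [].
  have Hi : lo <= i < hi by lia.
  apply: (@runs_weaken _ _ _
    (tcost (Less x b) + (T + 6) + (d * (T + ecost b + 9) + (ecost b + 3)))
    _ (I hi)) => //; last by rewrite /=; lia.
  apply: (runs_while_step (P := fun s2 => I i.+1 s2 /\ s2 x 0 = i.+1)).
  - by rewrite /= okx.
  - by rewrite /= Eb xi; lia.
  - apply: runs_seq_frame (Hc _ _ Hi HI xi) _ => s2 HI2 Hf.
    apply: runs_weaken (vc_runs _) _ (fun s' H => H) => //=.
    have Ex : s2 x 0 = i by rewrite Hf.
    by rewrite !okx // Ex addn1 /upd eqxx /=.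
  - move=> s2 [HI2 x2]; apply: IH HI2 x2; lia.
apply: (@runs_weaken _ _ _
  (max_cost (Put x 0 a) + ((hi - lo) * (T + ecost b + 9) + (ecost b + 3)))
    _ (I hi)) => //; last by rewrite /=; lia.
apply: runs_vc_seq => /=; split.
  by rewrite all_rcons okx.
rewrite Ea; apply: (loop (hi - lo) lo) => //; first by lia.
by rewrite /upd !eqxx.
Qed.


(** * Numbered input and binary search *)

(** The two conjuncts are the negated first test and the second test of [locate]; [near_timeE] links
    them to the distance. *)
Definition near_times (D t t' : nat) : bool := (t <= t' + D) && (t' <= t + D).

Definition incn (s : memory) (x g : nat) : bool :=
  (s in_src g == x) || (s in_dst g == x).

Definition near_inc (s : memory) (x t g : nat) : bool :=
  incn s x g && near_times (s in_Delta 0) t (s in_time g).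

Definition ncount (s : memory) (R : pred nat) (x t : nat) : nat :=
  count (fun g => R g && near_inc s x t g) (iota 0 (s in_m 0)).

(** All that the analysis of the program uses about its input, in terms of numbers alone: [dmax]
    bounds the lengths of the incidence lists, [X] the number of near edges at one endpoint of an
    edge. Graphs return only with [encodes_numbered]. *)
Record numbered (s : memory) (n dmax X : nat) : Prop := Numbered {
  num_n : n <= 2 * s in_m 0;
  num_src : forall e, e < s in_m 0 -> s in_src e < n;
  num_dst : forall e, e < s in_m 0 -> s in_dst e < n;
  num_neq : forall e, e < s in_m 0 -> s in_src e != s in_dst e;
  num_off : forall x, x < n -> s in_off x <= s in_off x.+1 <= 2 * s in_m 0;
  num_deg : forall x, x < n -> s in_off x.+1 - s in_off x <= dmax;
  num_sorted : forall x i j, x < n -> s in_off x <= i <= j ->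
    j < s in_off x.+1 -> s in_time (s in_inc i) <= s in_time (s in_inc j);
  num_perm : forall x, x < n ->
    perm_eq
      [seq s in_inc j | j <- iota (s in_off x) (s in_off x.+1 - s in_off x)]
      [seq g <- iota 0 (s in_m 0) | incn s x g];
  num_xi : forall e x, e < s in_m 0 -> incn s x e ->
    ncount s predT x (s in_time e) <= X
}.

(** The arrays numbered below 8 are the input arrays, which the program never writes. *)
Definition agree (s0 s : memory) : Prop := forall a, arr_id a < 8 -> s a = s0 a.

Lemma upd_other s a i x b : b != a -> upd s a i x b = s b.
Proof. by rewrite /upd => /negbTE ->. Qed.

Lemma agree_upd s0 s a i x : 8 <= arr_id a -> agree s0 s -> agree s0 (upd s a i x).
Proof.
move=> Ha H b Hb; rewrite /upd; case: eqP => [E|_]; first by subst; lia.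
exact: H.
Qed.

Lemma agree_eq8 s0 s s' : agree s0 s ->
  s' in_n = s in_n -> s' in_m = s in_m -> s' in_Delta = s in_Delta ->
  s' in_src = s in_src -> s' in_dst = s in_dst -> s' in_time = s in_time ->
  s' in_off = s in_off -> s' in_inc = s in_inc -> agree s0 s'.
Proof.
by move=> H E0 E1 E2 E3 E4 E5 E6 E7 [[|[|[|[|[|[|[|[|a]]]]]]]]] // Ha; rewrite -H.
Qed.

Lemma agree_frame s0 s s' (l : seq arr) :
  agree s0 s -> (forall a : arr, a \notin l -> s' a = s a) ->
  all (fun a => 8 <= arr_id a) l -> agree s0 s'.
Proof.
move=> H Hf /allP Hl a Ha; rewrite Hf ?H //; apply/negP => /Hl /=; lia.
Qed.

Section Locate.
Variables (s0 : memory) (n dmax X : nat).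
Hypothesis num : numbered s0 n dmax X.
Local Notation m := (s0 in_m 0).
Local Notation off := (s0 in_off).
Local Notation inc := (s0 in_inc).
Local Notation B := (2 * m).

(** An interval shorter than [2 ^ k.+1] leaves, once its midpoint is discarded or made the right
    end, one shorter than [2 ^ k]; so k rounds suffice, each of cost at most 5 + 8 + 16 = 29. The
    test [before] is specified on every memory differing from [s] only in the three search
    variables. *)
Lemma bsearch_runs before res s x (p : nat -> bool) k :
  agree s0 s -> s v_x 0 = x -> x < n -> arr_id res < 33 ->
  off x.+1 - off x < 2 ^ k -> tcost before <= 10 ->
  (forall s' j, (forall a : arr, a \notin [:: v_l; v_r; v_mid] -> s' a = s a) ->
     s' v_mid 0 = j -> off x <= j < off x.+1 ->
     teval s' before = p j /\ all (okc B) (tcells s' before)) ->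
  (forall i j, off x <= i <= j -> j < off x.+1 -> p j -> p i) ->
  runs B (bsearch before res) s (k * 29 + 21)
    (fun s' => [/\ off x <= s' res 0 <= off x.+1,
       forall j, off x <= j < s' res 0 -> p j &
       forall j, s' res 0 <= j < off x.+1 -> ~~ p j]).
Proof.
move=> ag Ex xn r33 wk cb Hb Hmono; have offx := num_off num xn.
have xB : x.+1 <= B by have := num_n num; lia.
pose I l r (s' : memory) := [/\ s' v_l 0 = l /\ s' v_r 0 = r,
  forall a : arr, a \notin [:: v_l; v_r; v_mid] -> s' a = s a,
  off x <= l <= r /\ r <= off x.+1,
  forall j, off x <= j < l -> p j & forall j, r <= j < off x.+1 -> ~~ p j].
have loop l r s' : I l r s' -> r - l < 2 ^ k ->
  runs B (While (Less v_l v_r) (Seq (Put v_mid 0 (Half (Add v_l v_r)))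
    (If before (Put v_l 0 (Add v_mid 1)) (Put v_r 0 v_mid)))) s' (k * 29 + 5)
    (fun s' => exists l, I l l s').
  elim: k l r s' {wk} => [|k IH] l r s' [[El Er] Hf [lr rx] Hp Hnp] w.
    apply: runs_weaken (runs_while_end (Q := fun s' => exists l, I l l s')
      _ _ _ _) _ _ => //=.
      by rewrite El Er; rewrite expn0 in w; lia.
    have E : r = l by rewrite expn0 in w; lia.
    by rewrite E in Er rx Hnp; exists l; split=> //; lia.
  case: (ltnP l r) => ltlr; last first.
    apply: runs_weaken (runs_while_end (Q := fun s' => exists l, I l l s')
      _ _ _ _) _ _ => //=.
    - by rewrite El Er; lia.
    - have E : r = l by lia.
      by rewrite E in Er rx Hnp; exists l; split=> //; lia.
  set mid := (l + r)./2.
  have Hmid : l <= mid < r by rewrite /mid; lia.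
  have w2 : 2 ^ k.+1 = 2 * 2 ^ k by rewrite expnS.
  pose P s' := exists l' r', I l' r' s' /\ r' - l' < 2 ^ k.
  apply: (@runs_weaken _ _ _ (5 + (8 + (10 + 6)) + (k * 29 + 5)) _
    (fun s' => exists l, I l l s')) => //; try lia.
  apply: (runs_while_step (P := P)) => //=; first by rewrite El Er.
    apply: (@runs_seq _ _ _ _ 8 16 (fun s1 => I l r s1 /\ s1 v_mid 0 = mid)).
      apply: vc_runs => /=; split=> //.
      rewrite El Er -/mid; split=> //; split=> // a na.
      rewrite upd_other ?Hf //; apply: contraNneq na => ->; by rewrite !inE.
    move=> s1 [[[El1 Er1] Hf1 lr1 Hp1 Hnp1] Em1].
    have [Ev okb] : teval s1 before = p mid /\ all (okc B) (tcells s1 before).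
      by apply: Hb => //; lia.
    have HT : max_cost (Put v_l 0 (Add v_mid 1)) = 6 by [].
    apply: (@runs_weaken _ _ _ (tcost before + 6) _ P) => //; try lia.
    apply: runs_if => //; rewrite Ev => pm.
      apply: vc_runs => /=; split=> //; rewrite Em1 addn1.
      exists mid.+1, r; split; last by rewrite /mid in Hmid *; lia.
      split=> //.
      - move=> a na; rewrite upd_other ?Hf1 //; apply: contraNneq na => ->.
        by rewrite !inE.
      - by lia.
      - by move=> j Hj; apply: (Hmono j mid) => //; lia.
    apply: (@runs_weaken _ _ _ 4 _ P) => //; try lia.
    apply: vc_runs => /=; split=> //; rewrite Em1.
    exists l, mid; split; last by rewrite /mid in Hmid *; lia.
    split=> //.
    - move=> a na; rewrite upd_other ?Hf1 //; apply: contraNneq na => ->.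
      by rewrite !inE.
    - by lia.
    - move=> j Hj; apply: contra pm => pj; apply: (Hmono mid j) => //; lia.
  by move=> s1 [l' [r' [HI' w']]]; apply: IH HI' w'.
have -> : k * 29 + 21 = max_cost (Put v_l 0 (Get in_off v_x)) +
  (max_cost (Put v_r 0 (Get in_off (Add v_x 1))) + (k * 29 + 5 + 4)).
  by rewrite /=; lia.
apply: runs_vc_seq => /=; rewrite Ex /okc /=; split; first by lia.
rewrite (ag in_off isT).
have E1 : upd s v_l 0 (off x) v_x 0 = x by [].
have E2 : upd s v_l 0 (off x) in_off x.+1 = off x.+1 by rewrite -(ag in_off isT).
apply: runs_vc_seq => /=; rewrite E1 addn1 E2 /okc /=; split; first by lia.
apply: (@runs_seq _ _ _ _ (k * 29 + 5) 4 (fun s' => exists l, I l l s')).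
  apply: (loop (off x) (off x.+1)) => //; split=> //=.
  - by move=> a; rewrite !inE !negb_or => /and3P[n1 n2 _]; rewrite !upd_other.
  - lia.
  - by move=> j; lia.
  - by move=> j; lia.
move=> s1 [l [[El _] _ Hl Hp Hnp]].
apply: vc_runs; rewrite /= /upd eqxx /= El /okc /= r33; split=> //.
by split; [lia | |].
Qed.

Lemma inc_lt x j : x < n -> off x <= j < off x.+1 -> inc j < m /\ incn s0 x (inc j).
Proof.
move=> xn Hj; have: inc j \in [seq inc j | j <- iota (off x) (off x.+1 - off x)].
  by apply: map_f; rewrite mem_iota; lia.
by rewrite (perm_mem (num_perm num xn)) mem_filter mem_iota => /andP[-> ?]; lia.
Qed.

(** Chronological order makes the near edges contiguous in the incidence list. The permutation
    serves twice: its length gives the initial degrees, its members are the edges scanned during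
    peeling. *)
Lemma locate_runs s x t k :
  agree s0 s -> s v_x 0 = x -> x < n -> s v_t 0 = t -> dmax < 2 ^ k ->
  runs B locate s (k * 58 + 42) (fun s' => [/\ s' v_lo 0 <= s' v_hi 0 <= B &
    perm_eq [seq inc j | j <- iota (s' v_lo 0) (s' v_hi 0 - s' v_lo 0)]
      [seq g <- iota 0 m | near_inc s0 x t g]]).
Proof.
move=> ag Ex xn Et dk; have offx := num_off num xn; have degx := num_deg num xn.
have wk : off x.+1 - off x < 2 ^ k by lia.
have agf s' s'' : agree s0 s' ->
    (forall a : arr, a \notin [:: v_l; v_r; v_mid] -> s'' a = s' a) -> agree s0 s''.
  by move=> H Hf; apply: agree_frame H Hf _.
apply: (@runs_weaken _ _ _ ((k * 29 + 21) + (k * 29 + 21))); last first.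
- by move=> s'; exact.
- by lia.
apply: runs_seq_frame.
  apply: (bsearch_runs (x := x) (k := k)
    (p := fun j => s0 in_time (inc j) + s0 in_Delta 0 < t)) => //.
    move=> s' j Hf Ej Hj; have ag' := agf _ _ ag Hf; have [ltm _] := inc_lt xn Hj.
    rewrite /= Ej !(ag' in_time isT, ag' in_inc isT, ag' in_Delta isT) Hf // Et /okc /=; split=> //.
    lia.
  move=> i j Hi Hj; have := num_sorted num xn Hi Hj; lia.
move=> s1 [Hlo Hlo1 Hlo2] Hf1.
have ag1 : agree s0 s1 by apply: agree_frame ag Hf1 _.
have Ex1 : s1 v_x 0 = x by rewrite Hf1.
have Et1 : s1 v_t 0 = t by rewrite Hf1.
apply: runs_weaken; first apply: runs_frame.
  apply: (bsearch_runs (x := x) (k := k)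
    (p := fun j => s0 in_time (inc j) <= t + s0 in_Delta 0)) => //.
    move=> s' j Hf Ej Hj; have ag' := agf _ _ ag1 Hf; have [ltm _] := inc_lt xn Hj.
    rewrite /= Ej !(ag' in_time isT, ag' in_inc isT, ag' in_Delta isT) Hf // Et1 /okc /=; split=> //.
    lia.
  move=> i j Hi Hj; have := num_sorted num xn Hi Hj; lia.
- by [].
move=> s2 [[Hhi Hhi1 Hhi2] Hf2]; rewrite (Hf2 v_lo) //.
move: (s1 v_lo 0) (s2 v_hi 0) Hlo Hlo1 Hlo2 Hhi Hhi1 Hhi2 => lo hi Hlo Hlo1 Hlo2.
move=> Hhi Hhi1 Hhi2.
(* Were [hi < lo], the entry at [hi] would be both earlier than t - Delta and later than t +
   Delta. *)
have lohi : lo <= hi.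
  rewrite leqNgt; apply/negP => lt; have := Hlo1 hi; have := Hhi2 hi; lia.
split; first by lia.
(* The list splits into a part too early, the near part and a part too late; filtering by [q] keeps
   exactly the middle one. *)
have E : iota (off x) (off x.+1 - off x) =
    iota (off x) (lo - off x) ++ iota lo (hi - lo) ++ iota hi (off x.+1 - hi).
  have -> : off x.+1 - off x = (lo - off x) + ((hi - lo) + (off x.+1 - hi)) by lia.
  by rewrite !iotaD; congr (_ ++ (iota _ _ ++ iota _ _)); lia.
pose q g := near_times (s0 in_Delta 0) t (s0 in_time g).
have -> : [seq g <- iota 0 m | near_inc s0 x t g] =
    filter q [seq g <- iota 0 m | incn s0 x g].
  by rewrite -filter_predI; apply: eq_filter => g; rewrite /= /near_inc andbC.
have Hq j : j \in iota (off x) (off x.+1 - off x) ->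
    q (inc j) = (lo <= j < hi).
  rewrite mem_iota => Hj; rewrite /q /near_times.
  have H1 := Hlo1 j; have H2 := Hlo2 j; have H3 := Hhi1 j; have H4 := Hhi2 j; lia.
apply: perm_trans (perm_filter q (num_perm num xn)).
rewrite filter_map (eq_in_filter Hq) E !filter_cat.
rewrite (eq_in_filter (a2 := pred0)) ?filter_pred0 /=; last first.
  by move=> j; rewrite mem_iota; lia.
rewrite (eq_in_filter (a2 := predT)) ?filter_predT /=; last first.
  by move=> j; rewrite mem_iota; lia.
rewrite (eq_in_filter (a2 := pred0)) ?filter_pred0 ?cats0 //.
by move=> j; rewrite mem_iota /=; lia.
Qed.
End Locate.


(** * Initial degrees *)

Section InitDegrees.
Variables (s0 : memory) (n dmax X : nat).
Hypothesis num : numbered s0 n dmax X.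
Local Notation m := (s0 in_m 0).
Local Notation B := (2 * m).

Definition init_spec (s : memory) (g : nat) : Prop :=
  [/\ s au g = ncount s0 predT (s0 in_src g) (s0 in_time g),
      s av g = ncount s0 predT (s0 in_dst g) (s0 in_time g),
      s dval g = minn (s au g) (s av g) & s alive g = 1].

Lemma locate_size x t lo hi :
  perm_eq [seq s0 in_inc j | j <- iota lo (hi - lo)]
    [seq g <- iota 0 m | near_inc s0 x t g] -> hi - lo = ncount s0 predT x t.
Proof. by move/perm_size; rewrite size_map size_iota size_filter. Qed.

Lemma init_degrees_runs s k :
  agree s0 s -> dmax < 2 ^ k ->
  runs B init_degrees s (m * (k * 116 + 150) + 8)
    (fun s' => agree s0 s' /\ forall g, g < m -> init_spec s' g).
Proof.
move=> ag dk; apply: (@runs_weaken _ _ _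
  ((m - 0) * (k * 116 + 139 + ecost in_m + 9) + (ecost 0 + ecost in_m + 5)) _
  (fun s' => agree s0 s' /\ forall g, g < m -> init_spec s' g)) => //; last first.
  by rewrite /=; lia.
apply: (runs_for (I := fun i s' => agree s0 s' /\ forall g, g < i -> init_spec s' g))
  => //.
- by split=> //; apply: agree_upd.
- by move=> i s1 [ag1 _] _; rewrite /= ag1 //.
move=> e s1 /= em [ag1 Hs1] Ee.
have sm := num_src num em; have dm := num_dst num em; have nm := num_n num.
apply: runs_le.
- apply: runs_vc_seq => /=; rewrite Ee (ag1 in_time isT) /okc /=; split; first by lia.
  set s2 := upd s1 _ _ _; have Ee2 : s2 v_e 0 = e by [].
  have ag2 : agree s0 s2 by apply: agree_upd.
  apply: runs_vc_seq => /=; rewrite Ee2 (ag2 in_src isT) /okc /=; split; first by lia.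
  set s3 := upd s2 _ _ _.
  have ag3 : agree s0 s3 by apply: agree_upd.
  apply: runs_seq_frame; first apply: (locate_runs num ag3 (erefl _) sm (erefl _) dk).
  move=> s4 [Hlh /locate_size E4] Hf4.
  have ag4 : agree s0 s4 by apply: agree_frame ag3 Hf4 _.
  have Ee4 : s4 v_e 0 = e by rewrite Hf4.
  have Et4 : s4 v_t 0 = s0 in_time e by rewrite Hf4.
  apply: runs_vc_seq => /=; rewrite Ee4 /okc /=; split; first by lia.
  rewrite E4.
  set s5 := upd s4 _ _ _; have Ee5 : s5 v_e 0 = e by [].
  have ag5 : agree s0 s5 by apply: agree_upd.
  apply: runs_vc_seq => /=; rewrite Ee5 (ag5 in_dst isT) /okc /=; split; first by lia.
  set s6 := upd s5 _ _ _.
  have ag6 : agree s0 s6 by apply: agree_upd.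
  apply: runs_seq_frame; first apply: (locate_runs num ag6 (erefl _) dm (erefl _) dk).
  move=> s7 [Hlh7 /locate_size E7] Hf7.
  have ag7 : agree s0 s7 by apply: agree_frame ag6 Hf7 _.
  have Ee7 : s7 v_e 0 = e by rewrite Hf7.
  (* Arrays 8 to 11 are [au], [av], [dval] and [alive]; [locate] touches none of them. *)
  have A7 a : arr_id a \in [:: 8; 9; 10; 11] -> s7 a = s5 a.
    by case: a => [] [|[|[|[|[|[|[|[|[|[|[|[|a]]]]]]]]]]]] // _; rewrite Hf7.
  have H4 a : arr_id a \in [:: 8; 9; 10; 11] -> s4 a = s1 a.
    by case: a => [] [|[|[|[|[|[|[|[|[|[|[|[|a]]]]]]]]]]]] // _; rewrite Hf4.
  apply: vc_runs => /=; rewrite Ee7 E7.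
  rewrite /upd /= !Ee7 !eqxx /okc /=.
  have Eau : s7 au e = ncount s0 predT (s0 in_src e) (s0 in_time e).
    by rewrite A7 // /s5 /upd !eqxx.
  have -> : s6 v_t 0 = s0 in_time e by rewrite -Et4.
  have -> : s6 v_x 0 = s0 in_dst e by [].
  have ne8 b a : arr_id b < 8 -> 8 <= arr_id a -> (b == a) = false.
    by move=> Hb Ha; apply/eqP => E; subst; lia.
  split; first by lia.
  split; first by lia.
  case: ifP => Hle; (split; first by lia); (split; first by lia);
    (split; first by (move=> b Hb; rewrite !ne8 ?(ag7 b)));
    move=> g; rewrite ltnS leq_eqVlt => /orP[/eqP ->|ge];
    rewrite /init_spec /upd /= ?eqxx //;
    try (by rewrite Eau; split=> //; move: Hle; rewrite Eau /minn; case: ltngtP);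
    have [] := Hs1 g ge; have -> : (g == e) = false by lia.
    by rewrite !A7 // /s5 /upd /= !H4 // (_ : (g == e) = false) //; lia.
  by rewrite !A7 // /s5 /upd /= !H4 // (_ : (g == e) = false) //; lia.
- by rewrite /=; lia.
Qed.
End InitDegrees.


(** * Bin sort *)

(* The last clause says both that [od] is sorted by value and that [bn k] is the
   position of its first edge of value at least k. *)
Record buckets (m : nat) (dv od ps bn : nat -> nat) : Prop := Buckets {
  bk_le : forall g, g < m -> dv g <= m;
  bk_pos : forall g, g < m -> ps g < m /\ od (ps g) = g;
  bk_ord : forall j, j < m -> od j < m /\ ps (od j) = j;
  bk_bin_le : forall k, k <= m -> bn k <= m;
  bk_bin : forall k g, k <= m -> g < m -> (ps g < bn k) = (dv g < k)
}.

Section Rank.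
Variables (m : nat) (d : nat -> nat).

Definition num_below k := count (fun h => d h < k) (iota 0 m).
Definition num_at i k := count (fun h => d h == k) (iota 0 i).
(** The position of g in the stable sort by value: after all smaller values and after the equal
    values of smaller edge number. *)
Definition rank g := num_below (d g) + num_at g (d g).

Lemma num_belowS k : num_below k.+1 = num_below k + num_at m k.
Proof.
rewrite /num_below /num_at; elim: (iota 0 m) => //= h l ->; lia.
Qed.

Lemma num_below0 : num_below 0 = 0.
Proof. by rewrite /num_below; elim: (iota 0 m). Qed.

Lemma num_below_le k : num_below k <= m.
Proof. by rewrite -[X in _ <= X](size_iota 0 m) count_size. Qed.

Lemma num_below_mono k l : k <= l -> num_below k <= num_below l.
Proof. by move=> kl; apply: sub_count => h /=; lia. Qed.

Lemma num_atS i k : num_at i.+1 k = num_at i k + (d i == k).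
Proof. by rewrite /num_at -addn1 iotaD count_cat /= addn0 add0n. Qed.

Lemma num_at_mono i j k : i <= j -> num_at i k <= num_at j k.
Proof.
move=> /subnKC <-; elim: (j - i) => [|p IH]; first by rewrite addn0.
by rewrite addnS num_atS; lia.
Qed.

(** The rank lies in the block from [num_below (d g)] up to, but excluding, [num_below (d g).+1],
    and [num_below] is monotone. *)
Lemma rank_lt g : g < m -> forall k, (rank g < num_below k) = (d g < k).
Proof.
move=> gm k; have := @num_atS g (d g); have := num_at_mono (d g) gm.
have := num_belowS (d g); rewrite eqxx /rank.
case: (ltnP (d g) k) => [/num_below_mono|/num_below_mono]; lia.
Qed.

Lemma rank_ltm g : g < m -> rank g < m.
Proof.
move=> gm; have := rank_lt gm (d g).+1; have := num_below_le (d g).+1; lia.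
Qed.

(** Equal ranks lie in one block, so the values agree; within a block the count of earlier equal
    values grows strictly past each member. *)
Lemma rank_inj g h : g < m -> h < m -> rank g = rank h -> g = h.
Proof.
move=> gm hm E; have Ed : d g = d h.
  have := rank_lt gm (d h).+1; rewrite E (rank_lt hm).
  by have := rank_lt hm (d g).+1; rewrite -E (rank_lt gm); lia.
move: E; rewrite /rank Ed => /addnI E.
have := @num_atS g (d h); have := @num_atS h (d h); rewrite Ed eqxx.
by case: (ltngtP g h) => // /num_at_mono => /(_ (d h)); lia.
Qed.

Lemma rank_buckets od ps bn : (forall g, g < m -> d g <= m) ->
  (forall g, g < m -> ps g = rank g /\ od (rank g) = g) ->
  (forall k, k <= m -> bn k = num_below k) -> buckets m d od ps bn.
Proof.
move=> Hd Hp Hb; split=> //.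
- by move=> g gm; have [-> ->] := Hp g gm; split=> //; apply: rank_ltm.
- move=> j jm.
  (* An injection of a finite set into itself is onto, so every position is a rank. *)
  have: j \in [seq rank g | g <- iota 0 m].
    have U : uniq [seq rank g | g <- iota 0 m].
      rewrite map_inj_in_uniq ?iota_uniq // => g h.
      by rewrite !mem_iota => gm hm; apply: rank_inj.
    have S : {subset [seq rank g | g <- iota 0 m] <= iota 0 m}.
      by move=> i /mapP[g]; rewrite !mem_iota => gm -> /=; apply: rank_ltm.
    have [|_ ->] := uniq_min_size U S; first by rewrite size_map.
    by rewrite mem_iota.
  case/mapP=> g; rewrite mem_iota => gm ->; have [E1 E2] := Hp g gm.
  by rewrite E2 E1.
- by move=> k km; rewrite Hb //; apply: num_below_le.
- by move=> k g km gm; rewrite Hb // (Hp g gm).1 rank_lt.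
Qed.
End Rank.

Section BinSort.
Variable s0 : memory.
Local Notation m := (s0 in_m 0).
Local Notation B := (2 * m).

Lemma bin_sort_runs s :
  agree s0 s -> (forall g, g < m -> s dval g <= m) ->
  runs B bin_sort s (m * 150 + 100)
    (fun s' => buckets m (s dval) (s' ord) (s' pos) (s' bin)).
Proof.
move=> ag dm; set d := s dval.
apply: runs_le.
- apply: runs_seq_frame.
    apply: (runs_for (lo := 0) (hi := m.+1) (T := 4)
      (I := fun i s' => agree s0 s' /\ forall k, k < i -> s' bin k = 0)) => //.
    + by split=> //; apply: agree_upd.
    + by move=> i s1 [ag1 _] _; rewrite /= ag1 // addn1.
    move=> k s1 km [ag1 Hb] Ek; apply: vc_runs_le => //=; rewrite Ek /okc /=.
    split; first by lia.
    split; first by repeat apply: agree_upd => //.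
    move=> j jk; rewrite /upd /=; case: eqP => // ne; apply: Hb; lia.
  (* Counting: after i edges, [bin k] is the number of them with value k. *)
  move=> s1 [ag1 Hb1] Hf1; apply: runs_seq_frame.
    apply: (runs_for (lo := 0) (hi := m) (T := 11)
      (I := fun i s' => [/\ agree s0 s', s' dval = d &
         forall k, k <= m -> s' bin k = num_at d i k])) => //.
    + by split; [exact: agree_upd | by rewrite upd_other // Hf1 |].
    + by move=> i s2 [ag2 _ _] _; rewrite /= ag2.
    move=> e s2 em [ag2 Ed2 Hb2] Ee; have de := dm _ em.
    apply: vc_runs_le => //=; rewrite Ee Ed2 /okc /=.
    split; first by rewrite -/d in de; lia.
    split; [by repeat apply: agree_upd => // | by [] |].
    move=> k km; rewrite /upd /= num_atS eq_sym; case: eqP => [->|_]; rewrite Hb2 //.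
    by rewrite addn0.
  move=> s2 [ag2 Ed2 Hb2] Hf2; apply: runs_vc_seq => /=; split=> //.
  (* Prefix sums, in place: entries below the counter are already bin starts, the others still bin
     sizes. *)
  apply: runs_seq_frame.
    apply: (runs_for (lo := 0) (hi := m.+1) (T := 17)
      (I := fun i s' => [/\ agree s0 s', s' v_sum 0 = num_below m d i,
         forall k, k < i -> s' bin k = num_below m d k &
         forall k, i <= k <= m -> s' bin k = num_at d m k])) => //.
    + split; [by do 2 apply: agree_upd => // | by rewrite num_below0 | by [] |].
      by move=> k Hk; apply: Hb2; lia.
    + by move=> i s3 [ag3 _ _ _] _; rewrite /= ag3 // addn1.
    move=> k s3 km [ag3 Es Hb Hb'] Ek; apply: vc_runs_le => //=.
    rewrite Ek /okc /=; split; first by lia.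
    rewrite /upd /= Ek Es; split; first by lia.
    split=> //; split.
    + exact: (agree_eq8 ag3).
    + by rewrite num_belowS Hb' //; lia.
    + move=> j jk; rewrite /=; case: eqP => [-> //|ne]; apply: Hb; lia.
    + move=> j jk; rewrite /=; case: eqP => [|ne]; first by lia.
      by apply: Hb'; lia.
  move=> s3 [ag3 _ Hb3 _] Hf3.
  have Ed3 : s3 dval = d by rewrite Hf3 // upd_other.
  (* Placement: [bin k] is the next free position of bin k, which for the current edge is its
     rank. *)
  apply: runs_seq_frame.
    apply: (runs_for (lo := 0) (hi := m) (T := 32)
      (I := fun i s' => [/\ agree s0 s', s' dval = d,
         forall k, k <= m -> s' bin k = num_below m d k + num_at d i k &
         forall g, g < i -> s' pos g = rank m d g /\ s' ord (rank m d g) = g])) => //.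
    + split; [exact: agree_upd | by [] | | by []].
      by move=> k km; rewrite addn0; apply: Hb3.
    + by move=> i s4 [ag4 _ _ _] _; rewrite /= ag4.
    move=> e s4 em [ag4 Ed4 Hb4 Hp4] Ee; have de := dm _ em.
    have Er : s4 bin (d e) = rank m d e by rewrite Hb4.
    have rm := rank_ltm d em.
    have de2 : d e <= m by [].
    apply: vc_runs_le => //=; rewrite Ee Ed4 /okc /=.
    split; first by lia.
    rewrite /upd /= Ee !eqxx Er Ed4; split; first by lia.
    split; first by lia.
    split; [exact: (agree_eq8 ag4) | by [] | |].
    + move=> k km; rewrite num_atS; case: (k =P d e) => [->|ne] /=.
        by rewrite eqxx Er /rank addnA.
      rewrite Hb4 //; have -> : (d e == k) = false by apply/eqP => E; apply: ne.
      by rewrite addn0.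
    + move=> g ge; case: (g =P e) => [->|ne]; first by rewrite !eqxx.
      have gi : g < e by lia.
      have [E1 E2] := Hp4 g gi; rewrite /= E1; split=> //.
      by case: eqP => [/rank_inj E|//]; case: ne; apply: E; lia.
  move=> s4 [ag4 _ Hb4 Hp4] Hf4; apply: runs_vc_seq => /=; split=> //.
  rewrite (ag4 in_m isT).
  (* Placement has left the start of bin [j.+1] in [bin j]. Going down, entries above k are already
     shifted; entry 0 is repaired by the last assignment. *)
  pose I k s' := [/\ s' v_k 0 = k, k <= m, s' ord = s4 ord /\ s' pos = s4 pos,
    forall j, j <= k -> s' bin j = num_below m d j.+1 &
    forall j, k < j <= m -> s' bin j = num_below m d j].
  apply: (runs_seq (T1 := m * 18 + 4) (T2 := 3) (P := I 0)).
    have loop k s5 : I k s5 -> runs B (While (Less 0 v_k)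
      (bin@[v_k <~ bin@[v_k -' 1]] ;; v_k <~ v_k -' 1)%ram) s5
      (k * 18 + 4) (I 0).
    elim: k s5 => [|k IH] s5 HI.
      have [Ek _ _ _ _] := HI.
      by apply: runs_le; first apply: (runs_while_end (Q := I 0) _ _ _ _) => //=; rewrite ?Ek.
    have [Ek km Eo Hb Hb'] := HI.
    apply: runs_le; first apply: (runs_while_step (P := I k) (T1 := 14)) => //=;
      rewrite ?Ek //; last 2 first.
    + move=> s6; exact: IH.
    + by rewrite /=; lia.
    apply: vc_runs_le => //=; rewrite Ek /okc /= subn1 /=; split; first by lia.
    rewrite /upd /= Ek subn1 /=; split; first by lia.
    split=> //=; first by lia.
    + by move=> j jk; rewrite ifN ?Hb //; lia.
    + move=> j jk; case: eqP => [->|ne]; first by rewrite Hb.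
      by apply: Hb'; lia.
    apply: loop; split=> //; last by move=> j; lia.
    by move=> j jm; rewrite num_belowS; apply: Hb4.
  move=> s5 [_ _ [Eo Ep] Hb Hb']; apply: vc_runs_le => //=; split=> //.
  apply: rank_buckets => //.
  + by move=> g gm; rewrite /upd /= Eo Ep; apply: Hp4.
  + move=> [|k] km; rewrite /upd /=; first by rewrite num_below0.
    by apply: Hb'; lia.
- by rewrite /=; lia.
Qed.
End BinSort.


(** If h had the smaller value, the border [bn (dv g)] would put h strictly before g. *)
Lemma buckets_sorted m dv od ps bn g h : buckets m dv od ps bn ->
  g < m -> h < m -> ps g <= ps h -> dv g <= dv h.
Proof.
move=> bk gm hm; rewrite leqNgt => gh; rewrite leqNgt; apply: contra gh => gh.
have gk := bk_le bk gm.
have := bk_bin bk gk hm; have := bk_bin bk gk gm; lia.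
Qed.

(** * The peeling invariant *)

(* Exchanging f with the first edge of its bin, and moving the border of the
   bin to the right, lowers the value of f by one. *)
Lemma buckets_rebin m dv od ps bn dv' od' ps' bn' f :
  buckets m dv od ps bn -> f < m -> 0 < dv f ->
  (forall g, dv' g = if g == f then (dv f).-1 else dv g) ->
  (forall j, od' j = if j == bn (dv f) then f else
                     if j == ps f then od (bn (dv f)) else od j) ->
  (forall g, ps' g = if g == f then bn (dv f) else
                     if g == od (bn (dv f)) then ps f else ps g) ->
  (forall k, bn' k = if k == dv f then (bn k).+1 else bn k) ->
  [/\ buckets m dv' od' ps' bn',
      forall i g, i < bn (dv f) -> g < m -> (i <= ps' g) = (i <= ps g) &
      forall g, g < m -> ps g < bn (dv f) -> ps' g = ps g].
Proof.
move=> bk fm d0 Hd Ho Hp Hb.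
set pg := bn (dv f); rewrite -/pg in Ho Hp *.
have [pf_m Eof] := bk_pos bk fm; have df := bk_le bk fm.
have pg_pf : pg <= ps f by have := bk_bin bk df fm; rewrite -/pg; lia.
have pg_m : pg < m by lia.
have [gm Epg] := bk_ord bk pg_m; set g := od pg in gm Epg Ho Hp *.
(* Lying at the border, g has value at least [dv f]; lying no later than f, it has value at most
   [dv f]. *)
have dg : dv f <= dv g by have := bk_bin bk df gm; rewrite Epg -/pg; lia.
have dgf : dv g = dv f.
  by apply/eqP; rewrite eqn_leq dg andbT (buckets_sorted bk) // Epg.
(* The edge f may itself be first in its bin; the exchange is then the identity. *)
have fg : ps f = pg -> f = g by move=> E; rewrite -Eof E.
have inj h h' : h < m -> h' < m -> ps h = ps h' -> h = h'.
  by move=> hm hm' E; rewrite -(bk_pos bk hm).2 E (bk_pos bk hm').2.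
(* Both exchanged edges have positions from [bn (dv f)] on, so smaller positions, and comparisons
   with them, are unaffected. Peeling needs this for the removed prefix and the current edge. *)
split; last first.
- move=> h hm hpg; rewrite Hp; case: (h =P f) => [E|_]; first by subst h; lia.
  by case: (h =P g) => [E|//]; subst h; lia.
- move=> i h ipg hm; rewrite Hp; case: eqP => [->|_]; first by lia.
  by case: eqP => [->|_] //; rewrite Epg; lia.
- split.
- by move=> h hm; rewrite Hd; case: eqP => _; have := bk_le bk hm; lia.
- move=> h hm; rewrite Hp; case: (h =P f) => [->|hf]; first by rewrite Ho eqxx.
  case: (h =P g) => [->|hg]; rewrite Ho.
    rewrite eqxx; case: eqP => // E; split=> //.
    by rewrite fg.
  have [phm Eh] := bk_pos bk hm; split=> //.
  case: eqP => [E|_]; first by case: hg; apply: inj => //; rewrite Epg.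
  by case: eqP => [E|_] //; case: hf; apply: inj.
- move=> j jm; rewrite Ho; case: (j =P pg) => [->|jpg]; first by rewrite Hp eqxx.
  case: (j =P ps f) => [->|jpf]; rewrite Hp.
    by rewrite eqxx; case: eqP => // E; split=> //; rewrite E in Epg.
  have [ojm Ej] := bk_ord bk jm; split=> //.
  case: eqP => [E|_]; first by case: jpf; rewrite -E.
  by case: eqP => [E|_] //; case: jpg; rewrite -Epg -E.
- by move=> k km; rewrite Hb; case: eqP => [->|_]; [| apply: (bk_bin_le bk)].
move=> k h km hm; rewrite Hb Hd Hp.
have Hbf := bk_bin bk km fm; have Hbg := bk_bin bk km gm.
have Hbh := bk_bin bk km hm; rewrite dgf Epg in Hbg.
case: (h =P f) => [E|hf]; first by case: eqP => [->|ne]; rewrite -/pg; lia.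
case: (h =P g) => [E|hg].
  rewrite E dgf; case: eqP => [->|ne]; last by lia.
  have : ps f != pg by apply/eqP => /fg; congruence.
  by rewrite -/pg; lia.
case: eqP => [Ek|ne] //; rewrite Ek -/pg in Hbh *.
have : ps h != pg by apply/eqP => E; apply: hg; apply: inj => //; rewrite Epg.
lia.
Qed.

Section PeelInvariant.
Variables (s0 : memory) (n dmax X : nat).
Hypothesis num : numbered s0 n dmax X.
Local Notation m := (s0 in_m 0).
Local Notation src := (s0 in_src).
Local Notation dst := (s0 in_dst).
Local Notation time := (s0 in_time).

(** Minimum Delta-degree at least k, for edge numbers; [good_ddeg] identifies it with
    [all_ddeg_ge]. *)
Definition good (F : pred nat) (k : nat) : Prop :=
  forall f, f < m -> F f ->
    k <= ncount s0 F (src f) (time f) /\ k <= ncount s0 F (dst f) (time f).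

(* State of the peeling loop when the i first edges of [od] are removed and
   the edges whose value is below L are settled; [done x f] tells that the edge
   being processed is already discounted at the endpoint x of f. *)
Record peel_inv (i L : nat) (done : nat -> nat -> bool)
    (a_u a_v dv al od ps bn : nat -> nat) : Prop := PeelInv {
  pi_bk : buckets m dv od ps bn;
  pi_alive : forall g, g < m -> al g = (i <= ps g);
  pi_min : forall g, g < m -> dv g = minn (a_u g) (a_v g);
  pi_removed : forall g, g < m -> ps g < i -> dv g < L;
  pi_level : forall g, g < m -> i <= ps g -> L <= (dv g).+1;
  pi_exact : forall f, f < m -> al f = 1 -> L <= dv f ->
    a_u f + done (src f) f = ncount s0 (fun g => al g == 1) (src f) (time f) /\
    a_v f + done (dst f) f = ncount s0 (fun g => al g == 1) (dst f) (time f);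
  pi_upper : forall F k f, good F k -> f < m -> F f -> k <= dv f;
  pi_lower : forall k, k < L -> good (fun g => k <= dv g) k
}.

Lemma ncount_eq R R' x t :
  (forall g, g < m -> R g = R' g) -> ncount s0 R x t = ncount s0 R' x t.
Proof.
by move=> H; apply: eq_in_count => g; rewrite mem_iota => gm; rewrite /= H.
Qed.

Lemma ncount_sub (R R' : pred nat) x t :
  (forall g, g < m -> R g -> R' g) -> ncount s0 R x t <= ncount s0 R' x t.
Proof.
move=> H; rewrite /ncount -!size_filter; apply: uniq_leq_size.
  by rewrite filter_uniq ?iota_uniq.
move=> g; rewrite !mem_filter mem_iota => /andP[/andP[Rg ->] gm].
by rewrite H.
Qed.

Lemma ncount_rem (R : pred nat) e x t : e < m -> R e ->
  ncount s0 (fun g => R g && (g != e)) x t + near_inc s0 x t e = ncount s0 R x t.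
Proof.
move=> em Re; rewrite /ncount.
have -> : near_inc s0 x t e = count (fun g => (g == e) && near_inc s0 x t g) (iota 0 m) :> nat.
  rewrite -(eq_in_count (a1 := fun g => near_inc s0 x t e && (g == e))); last first.
    by move=> g _ /=; rewrite andbC; case: eqP => // ->.
  case: (near_inc s0 x t e); last by rewrite (eq_count (a2 := pred0)) ?count_pred0.
  rewrite (eq_count (a2 := pred1 e)) // count_uniq_mem ?iota_uniq //.
  by rewrite mem_iota em.
elim: (iota 0 m) => //= g l <-.
by case: (g =P e) => [->|_]; rewrite ?Re /= ?andbT ?andbF; lia.
Qed.

Lemma buckets_ext dv dv' od ps bn : (forall g, g < m -> dv' g = dv g) ->
  buckets m dv od ps bn -> buckets m dv' od ps bn.
Proof.
by move=> E [H1 H2 H3 H4 H5]; split=> // [g gm|k g km gm]; rewrite E ?H1 ?H5.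
Qed.

Lemma peel_inv_ext i L done done' a_u a_v dv al od ps bn :
  (forall x g, g < m -> done' x g = done x g) ->
  peel_inv i L done a_u a_v dv al od ps bn ->
  peel_inv i L done' a_u a_v dv al od ps bn.
Proof.
by move=> E [bk Hal Hmin Hrem Hlev Hex Hup Hlow]; split=> // f fm; rewrite !E //; apply: Hex.
Qed.

Lemma near_inc_sym x e f : near_inc s0 x (time e) f -> incn s0 x e ->
  near_inc s0 x (time f) e.
Proof. by rewrite /near_inc /near_times => /andP[_ /andP[-> ->]] ->. Qed.

(** With nothing removed and nothing settled, the only clause with content is [pi_upper], which is
    monotonicity of the counts. *)
Lemma peel_inv_init a_u a_v dv al od ps bn :
  buckets m dv od ps bn ->
  (forall g, g < m -> [/\ a_u g = ncount s0 predT (src g) (time g),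
     a_v g = ncount s0 predT (dst g) (time g),
     dv g = minn (a_u g) (a_v g) & al g = 1]) ->
  peel_inv 0 0 (fun _ _ => false) a_u a_v dv al od ps bn.
Proof.
move=> bk Hi; split=> //.
- by move=> g /Hi[].
- by move=> g /Hi[].
- move=> f fm _ _; have [-> -> _ _] := Hi f fm; rewrite !addn0.
  by split; apply: ncount_eq => g /Hi[_ _ _ ->].
- move=> F k f gF fm Ff; have [Eu Ev -> _] := Hi f fm; have [ku kv] := gF f fm Ff.
  rewrite leq_min Eu Ev (leq_trans ku) ?(leq_trans kv) //; exact: ncount_sub.
Qed.

Section Step.
Variables (i L : nat) (done : nat -> nat -> bool).
Variables (a_u a_v dv al od ps bn : nat -> nat).
Hypothesis inv : peel_inv i L done a_u a_v dv al od ps bn.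

(** The bound becomes one more than the value of the edge to be removed, so that [L <= dv f] is the
    algorithm's test d[f] > d[e]. The new work is [pi_lower] for k from the old bound up to that
    value. *)
Lemma peel_inv_start : (forall x f, done x f = false) -> i < m ->
  peel_inv i (dv (od i)).+1 done a_u a_v dv al od ps bn.
Proof.
move=> done0 im; have [bk Hal Hmin Hrem Hlev Hex Hup Hlow] := inv.
have [em Epe] := bk_ord bk im; set e := od i in em Epe *.
have Le : L <= (dv e).+1 by apply: Hlev => //; rewrite Epe.
have Hge g : g < m -> i <= ps g -> dv e <= dv g.
  by move=> gm ig; apply: (buckets_sorted bk) => //; rewrite Epe.
split=> //.
- by move=> g gm gi; rewrite ltnS (buckets_sorted bk) // Epe ltnW.
- move=> f fm al1 ltd; apply: Hex => //; lia.
move=> k ke; have [kL|Lk] := ltnP k L; first exact: Hlow.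
(* The level passes k: the edges of value >= k are exactly the remaining ones. *)
have E g : g < m -> (k <= dv g) = (al g == 1).
  move=> gm; rewrite Hal //; case: (leqP i (ps g)) => H /=.
    by have := Hge _ gm H; lia.
  by have := Hrem _ gm H; lia.
move=> f fm kf; have al1 : al f = 1 by apply/eqP; rewrite -E.
have [<- <-] : ncount s0 (fun g => al g == 1) (src f) (time f) =
    ncount s0 (fun g => k <= dv g) (src f) (time f) /\
    ncount s0 (fun g => al g == 1) (dst f) (time f) =
    ncount s0 (fun g => k <= dv g) (dst f) (time f).
  by split; apply: ncount_eq => g gm; rewrite E.
have [|<- <-] := Hex f fm al1; first by lia.
by rewrite !done0; have := Hmin f fm; lia.
Qed.

(** Exact counters are claimed only for remaining edges with value at least L, so any other edge can
    be marked without changing its counters. *)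
Lemma peel_inv_skip x f : al f <> 1 \/ dv f < L ->
  peel_inv i L (fun y g => done y g || (y == x) && (g == f))
    a_u a_v dv al od ps bn.
Proof.
move=> Hf; have [bk Hal Hmin Hrem Hlev Hex Hup Hlow] := inv; split=> // g gm ag Lg.
case: (g =P f) => [E|_]; last by rewrite !andbF !orbF; apply: Hex.
by subst g; case: Hf => //; lia.
Qed.

(** The counter at x drops as the mark of f at x is set, so their sum stays the exact count. The
    value of f starts above that of e and loses at most one; hence it stays at or above the level,
    and no set [k <= dv g] with k < L changes. *)
Lemma peel_inv_update x e f a_u' a_v' dv' od' ps' bn' :
  e < m -> ps e = i -> incn s0 x e -> f < m -> near_inc s0 x (time e) f ->
  ~~ done x f -> L = (dv e).+1 -> al f = 1 -> L <= dv f ->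
  (forall g, a_u' g = if (g == f) && (src f == x) then (a_u g).-1 else a_u g) ->
  (forall g, a_v' g = if (g == f) && (src f != x) then (a_v g).-1 else a_v g) ->
  (forall g, dv' g = if g == f then minn (a_u' f) (a_v' f) else dv g) ->
  buckets m dv' od' ps' bn' ->
  (forall g, g < m -> (i <= ps' g) = (i <= ps g)) ->
  peel_inv i L (fun y g => done y g || (y == x) && (g == f))
    a_u' a_v' dv' al od' ps' bn'.
Proof.
move=> em Epe xe fm nf ndone EL alf Lf Hu Hv Hd bk' Hps.
have [bk Hal Hmin Hrem Hlev Hex Hup Hlow] := inv.
have sdf := num_neq num fm.
have xf : src f != x -> dst f = x.
  by move: nf => /andP[/orP[/eqP ->|/eqP -> //] _]; rewrite eqxx.
have [Exu Exv] := Hex f fm alf Lf.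
have Hmf := Hmin f fm.
have df : dv' f = minn (a_u' f) (a_v' f) by rewrite Hd eqxx.
have uf : a_u' f = a_u f - (src f == x).
  by rewrite Hu eqxx; case: (src f == x) => /=; lia.
have vf : a_v' f = a_v f - (src f != x).
  by rewrite Hv eqxx; case: (src f == x) => /=; lia.
have dL : L <= (dv' f).+1 by lia.
have alE : al e = 1 by rewrite Hal // Epe leqnn.
split=> //.
- by move=> g gm; rewrite Hps // Hal.
- move=> g gm; rewrite Hd; case: (g =P f) => [->|ne] //.
  by rewrite Hu Hv; move/eqP/negbTE: ne => ->; apply: Hmin.
- move=> g gm ltgi; have gi : ps g < i by rewrite ltnNge -Hps // -ltnNge.
  rewrite Hd; case: (g =P f) => [E|_]; last exact: Hrem.
  by subst g; move: (Hal f fm); rewrite alf leqNgt gi.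
- move=> g gm; rewrite Hps // => ig; rewrite Hd.
  by case: (g =P f) => [_|_]; [rewrite -df | apply: Hlev].
- move=> g gm ag; rewrite Hd (Hu g) (Hv g); case: (g =P f) => [E|_] Lg.
    subst g; rewrite -Exu -Exv !andbT /=; move: uf vf; rewrite Hu Hv eqxx /=.
    case: (src f =P x) => [Ex|nx] /=.
      have -> : (dst f == x) = false by rewrite -Ex eq_sym; apply/negbTE.
      move: ndone; rewrite -Ex => /negbTE ->; rewrite !orbF /=; lia.
    move: ndone; rewrite -(xf _); last by apply/eqP.
    by rewrite eqxx => /negbTE ->; rewrite !orbF /=; lia.
  by rewrite /= !andbF !orbF; apply: Hex.
- move=> F k g gF gm Fg; have := Hup F k g gF gm Fg; rewrite Hd.
  case: (g =P f) => [E|_] // kd; subst g; rewrite -df.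
  have [kL|Lk] := ltnP k L; first by lia.
  (* The edges of F have values >= k > dv e, so none of them was removed and
     e is not one of them: F loses nothing, while the counter was exact. *)
  have FR g : g < m -> F g -> (al g == 1) && (g != e).
    move=> g'm Fg'; have := Hup F k g gF g'm Fg'; rewrite Hal //.
    move=> kg; apply/andP; split; last by apply: contraTneq kg => ->; lia.
    by case: leqP => // H; have := Hrem g g'm H; lia.
  have [ku kv] := gF f fm Fg.
  have Hne y t := ncount_sub y t FR.
  have Hr y t := ncount_rem y t em (introT eqP alE : (fun g => al g == 1) e).
  have := near_inc_sym nf xe.
  have Hu1 := Hne (src f) (time f); have Hu2 := Hr (src f) (time f).
  have Hv1 := Hne (dst f) (time f); have Hv2 := Hr (dst f) (time f).
  move=> nx; case: (src f =P x) => [Ex|/eqP nex].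
    have Nd : ~~ done (src f) f by rewrite Ex.
    move: Hu2; rewrite Ex nx -Ex; move: uf vf; rewrite Ex eqxx /=.
    rewrite Ex in Hu1 ku Exu Nd; rewrite (negbTE Nd) in Exu; lia.
  have Ex := xf nex.
  move: uf vf; rewrite nex (negbTE nex) /=.
  rewrite Ex in Hv1 Hv2 kv Exv; rewrite (negbTE ndone) in Exv.
  rewrite nx in Hv2; lia.
- move=> k kL; have E g : g < m -> (k <= dv' g) = (k <= dv g).
    by move=> gm; rewrite Hd; case: (g =P f) => [->|//]; rewrite -df; lia.
  move=> g gm; rewrite E // => kg; have [ku kv] := Hlow k kL g gm kg.
  by rewrite !(ncount_eq _ _ E).
Qed.

(** Once both endpoints are scanned, the mark of an edge equals the contribution of e to its count;
    erasing the marks and deleting e cancel out. *)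
Lemma peel_inv_finish e al' : i < m -> e = od i -> L = (dv e).+1 ->
  (forall g x, g < m -> incn s0 x g -> done x g = near_inc s0 x (time g) e) ->
  (forall g, al' g = if g == e then 0 else al g) ->
  peel_inv i.+1 L (fun _ _ => false) a_u a_v dv al' od ps bn.
Proof.
move=> im Ee EL Hdone Hal'; have [bk Hal Hmin Hrem Hlev Hex Hup Hlow] := inv.
have [em Epe] := bk_ord bk im; rewrite -Ee in em Epe.
have pse g : g < m -> g <> e -> ps g <> i.
  by move=> gm ge E; apply: ge; rewrite -(bk_pos bk gm).2 E.
have alE : al e = 1 by rewrite Hal // Epe leqnn.
split=> //.
- move=> g gm; rewrite Hal'; case: (g =P e) => [->|ne]; first by rewrite Epe ltnn.
  by rewrite Hal //; congr nat_of_bool; have := pse g gm ne; lia.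
- move=> g gm gi; case: (g =P e) => [->|ne]; first by rewrite EL.
  by apply: Hrem => //; have := pse g gm ne; lia.
- by move=> g gm gi; apply: Hlev => //; apply: ltnW.
move=> f fm; rewrite Hal'; case: (f =P e) => // ne alf Lf.
have [Eu Ev] := Hex f fm alf Lf.
have ER x : ncount s0 (fun g => al' g == 1) x (time f) =
    ncount s0 (fun g => (al g == 1) && (g != e)) x (time f).
  by apply: ncount_eq => g gm; rewrite Hal'; case: (g =P e); rewrite ?andbT ?andbF.
have Hr x := ncount_rem x (time f) em (introT eqP alE : (fun g => al g == 1) e).
rewrite !Hdone ?/incn ?eqxx ?orbT // in Eu Ev.
rewrite !ER; have := Hr (src f); have := Hr (dst f); lia.
Qed.

(** When every edge is removed, all values are below L, so for k from L on the set is empty. *)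
Lemma peel_inv_end k : i = m -> good (fun g => k <= dv g) k.
Proof.
move=> Ei; have [bk Hal Hmin Hrem Hlev Hex Hup Hlow] := inv.
have [/Hlow //|Lk] := ltnP k L.
move=> f fm kf; have := Hrem f fm; rewrite Ei (bk_pos bk fm).1 => /(_ isT); lia.
Qed.

End Step.
End PeelInvariant.


(** * The peeling loop *)

Section Peel.
Variables (s0 : memory) (n dmax X : nat).
Hypothesis num : numbered s0 n dmax X.
Local Notation m := (s0 in_m 0).
Local Notation B := (2 * m).
Local Notation inc := (s0 in_inc).

Definition peel_state (i L : nat) (done : nat -> nat -> bool) (s : memory) : Prop :=
  peel_inv s0 i L done (s au) (s av) (s dval) (s alive) (s ord) (s pos) (s bin).

Lemma rebin_runs s f old :
  s v_f 0 = f -> s v_old 0 = old -> f <= B -> old <= B -> s pos f <= B ->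
  s bin old <= B -> s ord (s bin old) <= B ->
  runs B rebin s 45 (fun s' =>
    [/\ forall j, s' ord j = if j == s bin old then f else
                    if j == s pos f then s ord (s bin old) else s ord j,
        forall g, s' pos g = if g == f then s bin old else
                    if g == s ord (s bin old) then s pos f else s pos g &
        forall k, s' bin k = if k == old then (s bin k).+1 else s bin k]).
Proof.
move=> Ef Eo fB oB pB bB gB; apply: vc_runs_le => //=.
rewrite /okc /upd /= !Ef !Eo /= addn1.
by do 8 (split; first lia); split=> // k; case: eqP => // ->.
Qed.

Lemma update_edge_runs s i done x e f :
  agree s0 s -> peel_state i (s dval e).+1 done s ->
  s v_f 0 = f -> s v_x 0 = x -> e < m -> s pos e = i -> incn s0 x e ->
  f < m -> near_inc s0 x (s0 in_time e) f -> ~~ done x f ->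
  s alive f = 1 -> s dval e < s dval f ->
  runs B update_edge s 90 (fun s' => [/\ s' pos e = i, s' dval e = s dval e &
    peel_state i (s dval e).+1
      (fun y g => done y g || (y == x) && (g == f)) s']).
Proof.
move=> ag inv Ef Ex em Epe xe fm nf nd alf Lf; have bk := pi_bk inv.
have ef : e <> f by move=> E; rewrite E ltnn in Lf.
have upd_f := peel_inv_update num inv em Epe xe fm nf nd erefl alf Lf.
have du : s dval f = minn (s au f) (s av f) := pi_min inv fm.
have dfm := bk_le bk fm.
apply: runs_le.
- apply: runs_seq_frame.
    apply: (@runs_le _ _ _ 14 14 (fun s1 =>
      (forall g, s1 au g = if (g == f) && (s0 in_src f == x) then (s au g).-1 else s au g) /\
      (forall g, s1 av g = if (g == f) && (s0 in_src f != x) then (s av g).-1 else s av g)))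
      => //.
    apply: vc_runs_le => //=; rewrite Ef Ex (ag in_src isT) /okc /= !subn1.
    split; first by lia.
    case: eqP => _ /=; (split; first by lia); rewrite /upd /=; split=> g;
      rewrite ?andbF ?andbT //; by case: eqP => // ->.
  move=> s1 [Hu Hv] Hf1.
  have Ef1 : s1 v_f 0 = f by rewrite Hf1.
  have Ed1 : s1 dval = s dval by rewrite Hf1.
  apply: runs_vc_seq => /=; rewrite Ef1 Ed1 /okc /=; split; first by lia.
  apply: runs_seq_frame.
    apply: (@runs_le _ _ _ 13 13 (fun s2 => forall g, s2 dval g =
      if g == f then minn (s1 au f) (s1 av f) else s dval g)) => //.
    apply: vc_runs_le => //=; rewrite /upd /= Ef1 /okc /=; split; first by lia.
    by rewrite Ed1; case: leqP => H; (split; first by lia); move=> g; case: eqP.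
  move=> s2 Hd Hf2.
  have Ef2 : s2 v_f 0 = f by rewrite Hf2.
  have Eo2 : s2 v_old 0 = s dval f by rewrite Hf2.
  have Eau : s2 au = s1 au by rewrite Hf2.
  have Eav : s2 av = s1 av by rewrite Hf2.
  have Eal : s2 alive = s alive by rewrite Hf2 // upd_other // Hf1.
  have Eord : s2 ord = s ord by rewrite Hf2 // upd_other // Hf1.
  have Epos : s2 pos = s pos by rewrite Hf2 // upd_other // Hf1.
  have Ebin : s2 bin = s bin by rewrite Hf2 // upd_other // Hf1.
  (* Lowering one counter by one lowers the minimum by at most one, so a single [rebin] suffices. *)
  have Hmin : minn (s1 au f) (s1 av f) = s dval f \/
              minn (s1 au f) (s1 av f) = (s dval f).-1.
    by move: (Hu f) (Hv f); rewrite eqxx /=; case: eqP => _ /=; lia.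
  have de2 : s2 dval e = s dval e by rewrite Hd; case: eqP.
  apply: runs_if => /=; rewrite Ef2.
  + by rewrite /okc /=; lia.
  + rewrite Eo2 Hd eqxx => lt.
    have dlt : minn (s1 au f) (s1 av f) = (s dval f).-1 by lia.
    have [pf Eof] := bk_pos bk fm.
    have bf : s bin (s dval f) <= s pos f.
      by have := bk_bin bk dfm fm; lia.
    have [gm Epg] := bk_ord bk (leq_ltn_trans bf pf).
    apply: runs_weaken.
    * apply: runs_frame; apply: (rebin_runs Ef2 Eo2);
        rewrite ?Ebin ?Epos ?Eord; lia.
    * exact: leqnn.
    move=> s3 [[Ho3 Hp3 Hb3] Hf3]; rewrite !Ebin !Epos !Eord in Ho3 Hp3 Hb3.
    have Ed3 : s3 dval = s2 dval by rewrite Hf3.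
    have [||bk3 Hi3 Hlt3] := buckets_rebin (dv' := s3 dval) bk fm _ _ Ho3 Hp3 Hb3.
    * by lia.
    * by move=> g; rewrite Ed3 Hd dlt.
    (* The edge e has smaller value than f, so its position i precedes the bin of f and survives the
       exchange. *)
    have ib : i < s bin (s dval f) by rewrite -Epe (bk_bin bk).
    split; [by rewrite Hlt3 // Epe | by rewrite Ed3 |].
    rewrite /peel_state Hf3 // (Hf3 av) // (Hf3 alive) // Eau Eav Eal.
    apply: upd_f => //; last by move=> g gm'; apply: Hi3.
    by move=> g; rewrite Ed3 Hd.
  rewrite Eo2 Hd eqxx => nlt; apply: vc_runs_le => //=.
  have dE g : s2 dval g = s dval g by rewrite Hd; case: eqP => [->|//]; lia.
  rewrite Epos; split=> //; rewrite /peel_state Eau Eav Eal Epos Eord Ebin.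
  by apply: upd_f => //; apply: buckets_ext bk.
- by [].
Qed.

Lemma scan_endpoint_runs s i done x e k :
  agree s0 s -> peel_state i (s dval e).+1 done s -> dmax < 2 ^ k ->
  s v_e 0 = e -> s v_x 0 = x -> s v_t 0 = s0 in_time e ->
  e < m -> s pos e = i -> incn s0 x e -> x < n -> (forall g, done x g = false) ->
  runs B scan_endpoint s (k * 58 + X * 130 + 60) (fun s' =>
    [/\ s' pos e = i, s' dval e = s dval e &
    peel_state i (s dval e).+1
      (fun y g => done y g || (y == x) && near_inc s0 x (s0 in_time e) g) s']).
Proof.
move=> ag inv dk Ee Ex Et em Epe xe xn ndone.
apply: runs_le.
- apply: runs_seq_frame; first exact: (locate_runs num ag Ex xn Et dk).
  move=> s1 [/andP[lohi hiB] Hperm] Hf1; have ag1 : agree s0 s1 by apply: agree_frame ag Hf1 _.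
  set lo := s1 v_lo 0 in lohi Hperm *; set hi := s1 v_hi 0 in lohi hiB Hperm *.
  (* No edge occurs twice in the range, so each is discounted once at this endpoint. *)
  have Uinc : uniq [seq inc j | j <- iota lo (hi - lo)].
    by rewrite (perm_uniq Hperm) filter_uniq ?iota_uniq.
  have Minc g : (g \in [seq inc j | j <- iota lo (hi - lo)]) =
      near_inc s0 x (s0 in_time e) g && (g < m).
    by rewrite (perm_mem Hperm) mem_filter mem_iota.
  (* The edges visited before position j; at [hi] these are all edges near e at x. *)
  pose pre j g := g \in [seq inc t | t <- iota lo (j - lo)].
  have Epos1 : s1 pos = s pos by rewrite Hf1.
  have Ed1 : s1 dval = s dval by rewrite Hf1.
  apply: (@runs_weaken _ _ _ ((hi - lo) * (110 + ecost v_hi + 9) +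
    (ecost v_lo + ecost v_hi + 5)) (X * 130 + 18)
    (fun s' => [/\ agree s0 s', [/\ s' v_e 0 = e, s' v_x 0 = x & s' v_hi 0 = hi],
         s' pos e = i, s' dval e = s dval e &
         peel_state i (s dval e).+1
           (fun y g => done y g || (y == x) && pre hi g) s'])).
  + apply: (runs_for (lo := lo) (hi := hi)
      (I := fun j s' => [/\ agree s0 s',
         [/\ s' v_e 0 = e, s' v_x 0 = x & s' v_hi 0 = hi],
         s' pos e = i, s' dval e = s dval e &
         peel_state i (s dval e).+1
           (fun y g => done y g || (y == x) && pre j g) s'])) => //.
    * split; [exact: agree_upd | | by rewrite upd_other // Epos1 | |].
      - by rewrite !upd_other // (Hf1 v_e) // (Hf1 v_x).
      - by rewrite upd_other // Ed1.
      rewrite /peel_state !upd_other // !Hf1 //; apply: peel_inv_ext inv.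
      by move=> y g gm; rewrite /pre subnn /= andbF orbF.
    * by move=> j s2 [_ [_ _ Eh] _ _ _] _; rewrite /= Eh.
    move=> j s2 Hj [ag2 [Ee2 Ex2 Eh2] Ep2 Ed2 inv2] Ej.
    have : inc j \in [seq inc j | j <- iota lo (hi - lo)].
      by apply: map_f; rewrite mem_iota; lia.
    rewrite Minc => /andP[nf fm]; set f := inc j in nf fm.
    have preS : pre j.+1 =1 fun g => pre j g || (g == f).
      move=> g; rewrite /pre subSn; last by lia.
      rewrite -addn1 iotaD map_cat mem_cat /= inE; congr (_ || (_ == inc _)); lia.
    have npre : ~~ pre j f.
      move: Uinc; have -> : hi - lo = (j - lo) + (1 + (hi - j.+1)) by lia.
      rewrite !iotaD !map_cat !cat_uniq /= => /and3P[_ /norP[+ _] _].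
      by rewrite (_ : lo + (j - lo) = j) //; lia.
    have Eal2 := pi_alive inv2 fm.
    apply: runs_le.
    * apply: runs_vc_seq => /=; rewrite Ej (ag2 in_inc isT) /okc /= -/f.
      split; first by lia.
      set s3 := upd s2 _ _ _.
      have ag3 : agree s0 s3 by apply: agree_upd.
      pose Q s' := [/\ s' pos e = i, s' dval e = s dval e &
        peel_state i (s dval e).+1
           (fun y g => done y g || (y == x) && pre j.+1 g) s'].
      apply: (runs_weaken (T := 102) (T' := 102)); first apply: runs_frame.
        + apply: (@runs_le _ _ _ (tcost (Same alive@[v_f]%ram 1) +
            (tcost (Less dval@[v_e] dval@[v_f])%ram + 90)) 102 Q) => //.
          have Hskip : s2 alive f <> 1 \/ s2 dval f < (s dval e).+1 ->
              runs B Skip s3 1 Q.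
            move=> Hs; apply: vc_runs_le => //=; split=> //.
            apply: (@peel_inv_ext _ _ _ (fun y g => (done y g || (y == x) && pre j g)
              || (y == x) && (g == f))).
              by move=> y g gm; rewrite preS; case: (y == x); rewrite ?orbF ?orbA.
            exact: peel_inv_skip.
          apply: runs_if => /=; rewrite (_ : s3 v_f 0 = f) //.
          - by rewrite /okc /=; lia.
          - move=> /eqP al1; apply: runs_if => /=;
              rewrite (_ : s3 v_f 0 = f) // (_ : s3 v_e 0 = e) //.
            + by rewrite /okc /=; lia.
            + rewrite -[s3 dval]/(s2 dval) Ed2 => lt.
              have inv3 : peel_state i (s3 dval e).+1
                 (fun y g => done y g || (y == x) && pre j g) s3.
                by rewrite -[s3 dval]/(s2 dval) Ed2.
              apply: runs_weaken; first apply: (update_edge_runs (x := x) (f := f) ag3 inv3) => //.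
              - by rewrite ndone eqxx.
              - by rewrite -[s3 dval]/(s2 dval) Ed2.
              - by [].
              move=> s4 [E1 E2 E3]; rewrite -[s3 dval]/(s2 dval) Ed2 in E2 E3.
              split=> //; apply: peel_inv_ext E3 => y g gm.
              by rewrite preS; case: (y == x); rewrite ?orbF ?orbA.
            rewrite -[s3 dval]/(s2 dval) Ed2 => nlt.
            by apply: runs_le; first (apply: Hskip; right; lia).
          move=> /eqP al1; by apply: runs_le; first (apply: Hskip; left).
        + by [].
      move=> s4 [[E1 E2 E3] Hf4]; split.
      + by apply: agree_upd => //; apply: agree_frame ag3 Hf4 _.
      + by rewrite !upd_other // !Hf4.
      + by rewrite upd_other.
      + by rewrite upd_other.
      by rewrite /peel_state !upd_other.
    * by [].
  (* The scan also visits removed edges; X covers them, as it counts near edges in the original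
     graph. *)
  + have : hi - lo <= X.
      by rewrite (locate_size Hperm); exact: (num_xi num em xe).
    rewrite /=; nia.
  move=> s' [_ _ E1 E2 E3]; split=> //; apply: peel_inv_ext E3 => y g gm.
  by rewrite /pre Minc gm andbT.
- by rewrite /=; lia.
Qed.

Lemma peel_runs s k :
  agree s0 s -> peel_state 0 0 (fun _ _ => false) s -> dmax < 2 ^ k ->
  runs B peel s (m * (k * 116 + X * 260 + 160) + 8)
    (fun s' => exists L, peel_state m L (fun _ _ => false) s').
Proof.
move=> ag inv dk; apply: (@runs_weaken _ _ _
  ((m - 0) * (k * 116 + X * 260 + 149 + ecost in_m + 9) + (ecost 0 + ecost in_m + 5))
  _ (fun s' => agree s0 s' /\ exists L, peel_state m L (fun _ _ => false) s')).
- apply: (runs_for (I := fun i s' =>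
    agree s0 s' /\ exists L, peel_state i L (fun _ _ => false) s')) => //.
  + by split; [exact: agree_upd | exists 0; rewrite /peel_state !upd_other].
  + by move=> i s1 [ag1 _] _; rewrite /= ag1.
  move=> i s1 /= im [ag1 [L inv1]] Ei.
  have {L}inv1 := peel_inv_start inv1 (fun _ _ => erefl) im.
  have [em Epe] := bk_ord (pi_bk inv1) im; set e := s1 ord i in em Epe inv1.
  have sm := num_src num em; have dm := num_dst num em; have nm := num_n num.
  have nsd := num_neq num em.
  apply: runs_le.
  + apply: runs_vc_seq => /=; rewrite Ei /okc /= -/e; split; first by lia.
    set s2 := upd s1 _ _ _.
    have ag2 : agree s0 s2 by apply: agree_upd.
    apply: runs_vc_seq => /=; rewrite (_ : s2 v_e 0 = e) // (ag2 in_time isT) /okc /=.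
    split; first by lia.
    set s3 := upd s2 _ _ _.
    have ag3 : agree s0 s3 by apply: agree_upd.
    apply: runs_vc_seq => /=; rewrite (_ : s3 v_e 0 = e) // (ag3 in_src isT) /okc /=.
    split; first by lia.
    set s4 := upd s3 _ _ _.
    have ag4 : agree s0 s4 by apply: agree_upd.
    apply: runs_seq_frame.
      apply: (scan_endpoint_runs (e := e) (x := s0 in_src e) (i := i) ag4 inv1 dk) => //.
      by rewrite /incn eqxx.
    move=> s5 [Epe5 Ed5 inv5] Hf5.
    have ag5 : agree s0 s5 by apply: agree_frame ag4 Hf5 _.
    have Ee5 : s5 v_e 0 = e by rewrite Hf5.
    apply: runs_vc_seq => /=; rewrite Ee5 (ag5 in_dst isT) /okc /=.
    split; first by lia.
    set s6 := upd s5 _ _ _.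
    have ag6 : agree s0 s6 by apply: agree_upd.
    rewrite -[s4 dval]/(s1 dval) in Ed5 inv5.
    have Ed6 : s6 dval e = s1 dval e by [].
    rewrite -Ed6 in inv5.
    have Ee6 : s6 v_e 0 = e := Ee5.
    have Et6 : s6 v_t 0 = s0 in_time e by rewrite -[s6 v_t]/(s5 v_t) Hf5.
    apply: runs_seq_frame.
      apply: (scan_endpoint_runs (e := e) (x := s0 in_dst e) (i := i) ag6 inv5 dk) => //.
        by rewrite /incn eqxx orbT.
      (* The endpoints of e differ, so the first scan left no marks at the second endpoint. *)
      by move=> g; rewrite eq_sym (negbTE nsd).
    move=> s7 [Epe7 Ed7 inv7] Hf7; rewrite Ed6 in Ed7 inv7.
    have ag7 : agree s0 s7 by apply: agree_frame ag6 Hf7 _.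
    have Ee7 : s7 v_e 0 = e by rewrite Hf7.
    apply: vc_runs_le => /=; last exact: leqnn.
    rewrite Ee7 /okc /=; split; first by lia.
    split; first by do 2 apply: agree_upd => //.
    exists (s1 dval e).+1.
    apply: (peel_inv_finish inv7 (e := e)) => //.
    * by rewrite -Epe7 (bk_pos (pi_bk inv7) em).2.
    * by rewrite Ed7.
    (* At an endpoint x of g outside e both sides are false; at a common endpoint nearness in time
       is symmetric. *)
    * move=> g x gm; rewrite /near_inc /near_times /incn /=.
      by case: (s0 in_src e =P x) => [<-|ne];
        case: (s0 in_dst e =P x) nsd => [->|ne'] //=; rewrite ?eqxx ?orbT //=; lia.
  by rewrite /=; lia.
- by rewrite /=; lia.
by move=> s' [].
Qed.

(** The two conclusions bound the values from below on every good set and make every superlevel set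
    good; [core_number_eps] reads core numbers off them. *)
Lemma core_decomposition_runs s k :
  agree s0 s -> dmax < 2 ^ k ->
  runs B core_decomposition s (m * (k * 232 + X * 260 + 460) + 116) (fun s' =>
    (forall F k f, good s0 F k -> f < m -> F f -> k <= s' dval f) /\
    forall k, good s0 (fun g => k <= s' dval g) k).
Proof.
move=> ag dk; apply: runs_le.
- apply: runs_seq; first exact: (init_degrees_runs num ag dk).
  move=> s1 [ag1 Hi]; apply: runs_seq_frame.
    apply: (bin_sort_runs ag1) => g /Hi[-> -> -> _].
    by rewrite geq_min -[X in _ <= X](size_iota 0) count_size.
  move=> s2 bk Hf2; have ag2 : agree s0 s2 by apply: agree_frame ag1 Hf2 _.
  apply: runs_weaken; first apply: (peel_runs ag2 _ dk).
  + apply: peel_inv_init => [|g /Hi[Hu Hv Hd Ha]]; rewrite ?(Hf2 dval) //.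
    by rewrite (Hf2 au) // (Hf2 av) // (Hf2 alive).
  + exact: leqnn.
  move=> s3 [L inv3]; split; first exact: (pi_upper inv3).
  by move=> k'; apply: (peel_inv_end inv3).
lia.
Qed.
End Peel.


(** * From numbered edges to temporal graphs *)

Section Encoding.
Local Open Scope fset_scope.

Lemma near_timeE D t t' : near_time D t t' = near_times D t t'.
Proof. rewrite /near_time /near_times; lia. Qed.

Lemma card_fset_count (T : choiceType) (F E : {fset T}) (P : pred T) :
  F `<=` E -> #|` [fset f in F | P f]| = count (fun e => (e \in F) && P e) E.
Proof.
move=> /fsubsetP FE; rewrite -size_filter; apply/perm_size/uniq_perm.
- exact: fset_uniq.
- exact/filter_uniq/fset_uniq.
move=> e; rewrite mem_filter !inE /=; case: (boolP (e \in F)) => //= eF.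
by rewrite FE // andbT.
Qed.

Variables (V : finType) (G : tgraph V) (Delta : nat).
Variables (nu : V -> nat) (eps : tedge V -> nat) (s : memory).
Hypothesis nm : #|V| <= 2 * msize G.
Hypothesis enc : encodes G Delta nu eps s.
Local Notation m := (s in_m 0).
Let E : {fset tedge V} := tedges G.

Lemma nu_onto x : x < #|V| -> exists v, nu v = x.
Proof.
move=> xV; pose f v := Ordinal (enc_nu_lt enc v).
have finj : injective f by move=> u v [] /(enc_nu_inj enc).
have /mapP[v _ /(congr1 val) /= ->] : Ordinal xV \in codom f.
  by apply: inj_card_onto => //; rewrite card_ord.
by exists v.
Qed.

Lemma eps_perm : perm_eq [seq eps e | e <- E] (iota 0 m).
Proof.
have U : uniq [seq eps e | e <- E].
  by rewrite map_inj_in_uniq ?fset_uniq //; apply: (enc_eps_inj enc).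
have S : {subset [seq eps e | e <- E] <= iota 0 m}.
  by move=> i /mapP[e eE ->]; rewrite mem_iota (enc_m enc) (enc_eps_lt enc).
apply: uniq_perm => //; first exact: iota_uniq.
have [|_ //] := uniq_min_size U S.
by rewrite size_map size_iota (enc_m enc).
Qed.

Lemma eps_onto g : g < m -> exists2 e, e \in E & eps e = g.
Proof.
move=> gm; have: g \in [seq eps e | e <- E] by rewrite (perm_mem eps_perm) mem_iota.
by case/mapP => e eE ->; exists e.
Qed.

Lemma eps_ltm e : e \in E -> eps e < m.
Proof. by move=> eE; rewrite (enc_m enc) (enc_eps_lt enc). Qed.

Lemma incn_eps v e : e \in E -> incn s (nu v) (eps e) = (v \in e.1).
Proof.
move=> eE; have [u [w [-> Es Ed _]]] := enc_edge enc eE.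
rewrite /incn Es Ed !inE ![v == _]eq_sym.
by rewrite !(inj_eq (enc_nu_inj enc)).
Qed.

Lemma time_eps e : e \in E -> s in_time (eps e) = e.2.
Proof. by move=> eE; have [u [w []]] := enc_edge enc eE. Qed.

Lemma ncount_near F R v t : F `<=` E -> (forall e, e \in E -> R (eps e) = (e \in F)) ->
  ncount s R (nu v) t = near_count Delta F v t.
Proof.
move=> FE HR; rewrite /near_count (card_fset_count _ FE) /ncount.
rewrite -(permP eps_perm) count_map; apply: eq_in_count => e eE /=.
by rewrite HR // /near_inc incn_eps // time_eps // (enc_Delta enc) near_timeE.
Qed.

Lemma tdeg_count v : tdeg G v = count (fun e : tedge V => v \in e.1) E.
Proof.
rewrite /tdeg /incident (@card_fset_count _ E E) //; apply: eq_in_count => e /= -> //.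
Qed.

(** Handshake: after exchanging the sums, each edge contributes its two endpoints. Through [off_sum]
    this bounds every offset. *)
Lemma sum_tdeg : \sum_v tdeg G v = 2 * m.
Proof.
under eq_bigr => v _ do rewrite tdeg_count -sum1_count big_mkcond /=.
rewrite exchange_big /= (eq_big_seq (fun=> 2)) => [|e eE]; last first.
  by rewrite -big_mkcond sum1_card; apply: (tedgesP eE).
by rewrite big_const_seq count_predT iter_addn_0 (enc_m enc).
Qed.

Lemma off_sum x : x <= #|V| -> s in_off x = \sum_(v | nu v < x) tdeg G v.
Proof.
elim: x => [|x IH] xV; first by rewrite (enc_off0 enc) big_pred0.
have [v Ev] := nu_onto xV; rewrite -Ev (enc_off enc) Ev IH; last exact: ltnW.
rewrite [RHS](bigD1 v) /=; last by rewrite Ev.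
rewrite addnC; congr (_ + _)%N; apply: eq_bigl => w.
rewrite -Ev -(inj_eq (enc_nu_inj enc)); lia.
Qed.

Lemma off_le x : x <= #|V| -> s in_off x <= 2 * m.
Proof.
move=> xV; rewrite off_sum // -sum_tdeg [X in _ <= X](bigID (fun v => nu v < x)) /=.
exact: leq_addr.
Qed.

Lemma encodes_numbered : numbered s #|V| (max_tdeg G) (xi G Delta).
Proof.
split.
- by rewrite (enc_m enc).
- move=> g /eps_onto[e eE <-]; have [u [w [_ -> _ _]]] := enc_edge enc eE.
  exact: (enc_nu_lt enc).
- move=> g /eps_onto[e eE <-]; have [u [w [_ _ -> _]]] := enc_edge enc eE.
  exact: (enc_nu_lt enc).
- move=> g /eps_onto[e eE <-]; have [u [w [Ee -> -> _]]] := enc_edge enc eE.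
  rewrite (inj_eq (enc_nu_inj enc)); have := tedgesP eE.
  by rewrite Ee cards2; case: eqP.
- move=> x xV; rewrite off_le // andbT; have [v <-] := nu_onto xV.
  by rewrite (enc_off enc) leq_addr.
- move=> x /nu_onto[v <-]; rewrite (enc_off enc) addKn; exact: leq_bigmax.
- move=> x i j /nu_onto[v <-] ij; rewrite (enc_off enc) => jx.
  have [es [pes ses Ees]] := enc_inc enc v.
  have Sz : size es = tdeg G v by rewrite (perm_size pes).
  have H t : s in_off (nu v) <= t < s in_off (nu v) + tdeg G v ->
      s in_time (s in_inc t) = nth 0 [seq e.2 | e <- es] (t - s in_off (nu v)).
    move=> Ht; have tlt : t - s in_off (nu v) < tdeg G v by lia.
    have e0 : tedge V := (set0, 0).
    have := congr1 (fun l => nth 0 l (t - s in_off (nu v))) Ees.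
    rewrite (nth_map 0) ?size_iota // nth_iota // subnKC; last by lia.
    have: nth e0 es (t - s in_off (nu v)) \in incident G v.
      by rewrite -(perm_mem pes) mem_nth ?Sz.
    rewrite !inE => /andP[nE _] ->.
    by rewrite !(nth_map e0) ?Sz // time_eps.
  rewrite !H; try lia.
  by apply: (sorted_leq_nth leq_trans leqnn) => //; rewrite ?inE ?size_map ?Sz; lia.
- move=> x /nu_onto[v <-]; rewrite (enc_off enc) addKn.
  have [es [pes _ ->]] := enc_inc enc v.
  apply: perm_trans (perm_map eps pes) _.
  apply: perm_trans (perm_filter _ eps_perm); rewrite filter_map.
  apply: perm_map; apply: uniq_perm.
  + exact: fset_uniq.
  + exact/filter_uniq/fset_uniq.
  move=> e; rewrite mem_filter !inE /= [RHS]andbC.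
  by case: (boolP (e \in E)) => //= eE; rewrite incn_eps.
(* Edges near e at a common endpoint v are Delta-incident to e, with v witnessing the intersection,
   so [xi] bounds them. *)
move=> g x /eps_onto[e eE <-] He.
have [v Ev] : exists v, nu v = x.
  have [u [w [_ Es Ed _]]] := enc_edge enc eE.
  by case/orP: He; rewrite ?Es ?Ed => /eqP <-; eexists.
rewrite -Ev incn_eps // in He *; rewrite (ncount_near (F := E)) //.
rewrite time_eps //; apply: leq_trans (leq_bigmax_seq _ eE _) => //.
apply: fsubset_leq_card; apply/fsubsetP => f; rewrite !inE /=.
move=> /andP[-> /andP[vf nt]]; rewrite /= /dincident nt andbT.
by apply/set0Pn; exists v; rewrite inE He.
Qed.

Lemma good_ddeg F R k : F `<=` E -> (forall e, e \in E -> R (eps e) = (e \in F)) ->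
  good s R k <-> all_ddeg_ge Delta k F.
Proof.
move=> FE HR; split=> [gR u v t euv|gF].
  have eE := fsubsetP FE _ euv.
  have [u' [v' [Ee Es Ed Et]]] := enc_edge enc eE.
  have [|ku kv] := gR _ (eps_ltm eE); first by rewrite HR.
  rewrite Es Ed Et /= in ku kv Ee.
  rewrite !(ncount_near _ _ FE HR) in ku kv.
  (* The pair u, v may list the endpoints in the other order than the input arrays do. *)
  have H w : w \in [set u'; v'] -> k <= near_count Delta F w t.
    by rewrite !inE => /orP[] /eqP ->.
  by rewrite leq_min !H // -Ee !inE eqxx ?orbT.
move=> g /eps_onto[e eE <-]; rewrite HR // => eF.
have [u [v [Ee Es Ed Et]]] := enc_edge enc eE.
rewrite Es Ed Et !(ncount_near _ _ FE HR).
have := gF u v e.2; rewrite -Ee -surjective_pairing => /(_ eF).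
by rewrite leq_min => /andP.
Qed.

(** For k the value of e, the edges of value at least k form a good set, and every good set for k
    lies inside it; so it is the core for k. No core for a larger k contains e, as its members have
    values at least that k. *)
Lemma core_number_eps (d : nat -> nat) e : e \in E ->
  (forall F k f, good s F k -> f < m -> F f -> k <= d f) ->
  (forall k, good s (fun g => k <= d g) k) ->
  is_core_number G Delta e (d (eps e)).
Proof.
move=> eE Hup Hlow.
have upper F k f : F `<=` E -> all_ddeg_ge Delta k F -> f \in F -> k <= d (eps f).
  move=> FE gF fF; have fE := fsubsetP FE _ fF.
  (* F is passed to the numbered world as its image, from which injectivity of [eps] recovers it. *)
  have HR g : g \in E -> (eps g \in [seq eps h | h <- F]) = (g \in F).
    move=> gE; apply/mapP/idP => [[h hF]|gF']; last by exists g.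
    by move/(enc_eps_inj enc) => -> //; apply: (fsubsetP FE).
  apply: (Hup (fun g => g \in [seq eps h | h <- F])).
  - exact/(good_ddeg _ FE HR).
  - exact: eps_ltm.
  - exact: map_f.
split; last by move=> k' F [FE gF _]; apply: upper.
exists [fset f in E | d (eps e) <= d (eps f)]; last by rewrite !inE eE leqnn.
have FE : [fset f in E | d (eps e) <= d (eps f)] `<=` E.
  by apply/fsubsetP => f; rewrite !inE => /andP[].
split=> //.
  by apply/(good_ddeg (R := fun g => d (eps e) <= d g)) => // f fE; rewrite !inE fE.
move=> F' FE' gF' sF; apply/eqP; rewrite eqEfsubset sF andbT.
apply/fsubsetP => f fF'; rewrite !inE (fsubsetP FE' _ fF') /=.
exact: upper gF' fF'.
Qed.

(** Each edge is Delta-incident to itself. This lets terms linear in m be absorbed into m times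
    [xi]. *)
Lemma xi_gt0 : 0 < msize G -> 0 < xi G Delta.
Proof.
rewrite cardfs_gt0 => /fset0Pn[e eE].
apply: leq_trans (leq_bigmax_seq _ eE _) => //.
rewrite cardfs_gt0; apply/fset0Pn; exists e; rewrite !inE eE /= /dincident setIid.
rewrite near_timeE /near_times !leq_addr !andbT -card_gt0.
by rewrite (tedgesP eE).
Qed.
End Encoding.

(** All cells, those of the input included, lie in a box of 33 arrays with indices 0 to 2m. *)
Lemma space_le n m L : n <= 2 * m -> all (okc (2 * m)) L ->
  space n m L <= 33 * (2 * m).+1.
Proof.
move=> nm okL.
have -> : 33 * (2 * m).+1 =
    size [seq (Arr a, i) | a <- iota 0 33, i <- iota 0 (2 * m).+1].
  by rewrite size_allpairs !size_iota.
apply: uniq_leq_size; first exact: undup_uniq.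
have okin : all (okc (2 * m)) (input_cells n m).
  apply/allP => c; rewrite /input_cells; move: n.+1 (nm : n.+1 <= (2 * m).+1) => p pm.
  rewrite !mem_cat !in_nil ?(orbF, orFb) -!orbA ?orFb.
  case/or4P=> [/eqP -> //|/eqP -> //|/eqP -> //|H].
  have {H} [a [i [-> Ha Hi]]] : exists a i, [/\ c = (a, i), arr_id a < 33 & i <= 2 * m].
    case/orP: H => [|/or4P[]] /mapP[i]; rewrite mem_iota => Hi ->;
      by do 2 eexists; split; [reflexivity | | lia].
  by rewrite /okc Ha.
move=> [a i]; rewrite mem_undup => Hin.
have : okc (2 * m) (a, i).
  by move: Hin; rewrite mem_cat => /orP[]; [move/allP: okin | move/allP: okL]; apply.
case: a {Hin} => a /andP[a33 iB].
by apply/allpairsPdep; exists a, i; rewrite !mem_iota.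
Qed.

Theorem theorem4 :
  exists C : nat,
  forall (V : finType) (G : tgraph V) (Delta : nat)
         (nu : V -> nat) (eps : tedge V -> nat) (s : memory),
  #|V| <= 2 * msize G ->
  encodes G Delta nu eps s ->
  exists (s' : memory) (time : nat) (L : seq cell),
  [/\ exec core_decomposition s s' time L,
      forall e : tedge V, e \in tedges G ->
        is_core_number G Delta e (s' dval (eps e)),
      0 < msize G ->
        time <= C * (msize G * maxn (trunc_log 2 (max_tdeg G)) (xi G Delta)) &
      0 < msize G ->
        space #|V| (msize G) L <= C * msize G].
Proof.
(* 1300 = 232 + 260 + (232 + 460) + 116, from the logarithm, [xi], the terms linear in m and the
   additive constant. The second 232 pays for k being the truncated logarithm plus one. Space needs
   only 99 per edge. *)
exists 1300 => V G Delta nu eps s nm enc.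
have num := encodes_numbered nm enc.
have [s' [t [L [He Ht okL [Hup Hlow]]]]] :=
  core_decomposition_runs num (fun _ _ => erefl) (trunc_log_ltn (max_tdeg G) (isT : 1 < 2)).
rewrite (enc_m enc) in Ht okL.
exists s', t, L; split=> //.
- by move=> e eG; apply: (core_number_eps enc).
- move=> m0; apply: leq_trans Ht _; have := xi_gt0 Delta m0.
  set l := trunc_log _ _; set X := xi _ _; set M := maxn l X; move: (msize G) m0 => m m0 X0.
  have lM : m * l <= m * M by rewrite leq_mul2l leq_maxl orbT.
  have XM : m * X <= m * M by rewrite leq_mul2l leq_maxr orbT.
  have mX : m <= m * X by rewrite leq_pmulr.
  rewrite !mulnDr !(mulnCA m) !mulnA; lia.
- by move=> m0; apply: leq_trans (space_le nm okL) _; lia.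
Qed.
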